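(* Let $n\geqslant 2$ be an integer and let $X\subset\mathbb{P}^{n+1}$ be a general hypersurface of degree $d\geqslant 2$. Then, for any point $p\in X$ and for any integer $2\leqslant h\leqslant \min\{n+1,d\}$, the cone $V^h_p\subset\mathbb{P}^{n+1}$ of tangent lines of order $h$ to $X$ at $p$ has dimension $$\dim(V^h_p)=n+2-h.$$
   Context: The base field is $\mathbb{C}$. ''General hypersurface of degree $d$'' means that the hypersurface corresponds to a point of some nonempty Zariski open subset of the projective space $\mathbb{P}(\mathbb{C}[x_0,\dots,x_{n+1}]_d)$ parametrizing hypersurfaces of degree $d$ in $\mathbb{P}^{n+1}$ (in particular, one may assume $X$ to be smooth). Let $X=V(F)\subset\mathbb{P}^{n+1}$ be a smooth hypersurface, $F$ homogeneous of degree $d\geqslant 2$. For $p\in X$ and an integer $2\leqslant h\leqslant d$, the cone $V^h_p=V^h_{p,X}\subset\mathbb{P}^{n+1}$ of tangent lines of order $h$ at $p$ is the Zariski closure of the locus swept out by the lines $\ell\subset\mathbb{P}^{n+1}$ through $p$ such that either $\ell\subset X$ or $\ell$ meets $X$ at $p$ with intersection multiplicity at least $h$. Equivalently, $V^h_p$ is the common zero locus of the polynomials $G_1,\dots,G_{h-1}$, where $G_k$ is the homogeneous polynomial of degree $k$ $$G_k(x_0,\dots,x_{n+1})=\sum_{i_0+\cdots+i_{n+1}=k}\frac{k!}{i_0!\cdots i_{n+1}!}\,x_0^{i_0}\cdots x_{n+1}^{i_{n+1}}\,\frac{\partial^kF}{\partial x_0^{i_0}\cdots\partial x_{n+1}^{i_{n+1}}}(p).$$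 *)

(* Defs.v *)
From HB Require Import structures.
From mathcomp Require Import all_boot all_order all_algebra.
From mathcomp Require Import mpoly.
From mathcomp Require Import boolp classical_sets reals complex.

Set Implicit Arguments.
Unset Strict Implicit.
Unset Printing Implicit Defensive.

Import GRing.Theory.
Local Open Scope classical_set_scope.
Local Open Scope ring_scope.

(* A point of the projective space P^(N-1) is given by homogeneous coordinates,
   i.e. by a nonzero vector of K^N up to scaling; a subset of P^(N-1) is given
   by the (scaling-invariant) set of all coordinate vectors of its points. *)

Section ProjectiveZariski.
Variables (K : fieldType) (N : nat).
Implicit Types (x : 'rV[K]_N) (Z A U : set 'rV[K]_N).

Definition proj_space : set 'rV[K]_N := [set x : 'rV[K]_N | x != 0].

Definition zero_locus (S : set {mpoly K[N]}) : set 'rV[K]_N :=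
  [set x : 'rV[K]_N | x != 0 /\ forall f, S f -> f.@[x 0] = 0].

Definition zariski_closed Z : Prop :=
  exists S : set {mpoly K[N]},
    (forall f, S f -> exists e : nat, f \is e.-homog) /\ Z = zero_locus S.

Definition zariski_open U : Prop :=
  exists Z, zariski_closed Z /\ U = proj_space `\` Z.

Definition zariski_closure A : set 'rV[K]_N :=
  [set x : 'rV[K]_N | forall Z, zariski_closed Z -> A `<=` Z -> Z x].

Definition zariski_irreducible Z : Prop :=
  Z !=set0 /\
  forall A B, zariski_closed A -> zariski_closed B ->
    Z `<=` A `|` B -> Z `<=` A \/ Z `<=` B.

Definition has_irreducible_chain Z (l : nat) : Prop :=
  exists c : nat -> set 'rV[K]_N,
    (forall i, (i <= l)%N ->
       [/\ zariski_closed (c i), zariski_irreducible (c i) & c i `<=` Z]) /\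
    (forall i, (i < l)%N -> c i `<` c i.+1).

(* The dimension of the closed set Z is k: the largest length of a strict chain
   c 0 < ... < c k of irreducible closed subsets of Z. *)
Definition has_dimension Z (k : nat) : Prop :=
  has_irreducible_chain Z k /\
  forall l, has_irreducible_chain Z l -> (l <= k)%N.

End ProjectiveZariski.

Section TangentCone.
Variables (K : fieldType) (N : nat).
Implicit Types (F : {mpoly K[N]}) (p q : 'rV[K]_N).

Definition hypersurface F : set 'rV[K]_N := zero_locus [set F].

Definition proj_line p q : set 'rV[K]_N :=
  [set x : 'rV[K]_N | x != 0 /\ exists s t : K, x = s *: p + t *: q].

(* The univariate polynomial F(p + T q): the equation of V(F) on the line
   through p and q, in the affine coordinate T vanishing at p. *)
Definition restrict_to_line F p q : {poly K} :=
  mmap (@polyC K) (fun i => (p 0 i)%:P + q 0 i *: 'X) F.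

(* Meaningful only when the line is not contained in V(F): [mup 0 0] is 0. *)
Definition intersection_mult F p q : nat := mup 0 (restrict_to_line F p q).

Definition tangent_locus F (h : nat) p : set 'rV[K]_N :=
  [set x : 'rV[K]_N | exists q : 'rV[K]_N,
     [/\ free [:: p; q],
         proj_line p q `<=` hypersurface F \/
           (h <= intersection_mult F p q)%N
       & proj_line p q x]].

Definition tangent_cone F (h : nat) p : set 'rV[K]_N :=
  zariski_closure (tangent_locus F h p).

End TangentCone.

Section GeneralHypersurface.
Variables (K : fieldType) (m d : nat).

Definition form_monomial : finType :=
  {a : 'X_{1..m.+1 < d.+1} | mdeg a == d}.

(* The homogeneous coordinates of V(F) in the parameter space of hypersurfaces
   of degree d in P^m are the coefficients of F. *)
Definition form_coefficients (F : {mpoly K[m.+1]}) : 'rV[K]_#|form_monomial| :=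
  \row_i F@_(val (val (enum_val i))).

Definition for_general_hypersurface (P : {mpoly K[m.+1]} -> Prop) : Prop :=
  exists U : set 'rV[K]_#|form_monomial|,
    [/\ zariski_open U, U !=set0
      & forall F, F \is d.-homog -> U (form_coefficients F) -> P F].

End GeneralHypersurface.

(* Main.v *)
Require Import Defs.
From HB Require Import structures.
From mathcomp Require Import all_boot all_order all_algebra.
From mathcomp Require Import mpoly.
From mathcomp Require Import boolp classical_sets reals complex.
From mathcomp Require Import zify ring.

(* Normalize [p] by [p_a = 1] and write [F = \sum_i x_a ^ (d - i) * L_i (x - x_a p)], where [L_i] is a
   form of degree [i] in the other [n + 1] coordinates. The cone of order [h] is the zero locus of
   the [L_i (x - x_a p)] with [0 < i < h], so it has dimension at least [n + 2 - h], and the point is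
   to find, for general [F] and all [p], linear forms [l] in number [n + 1 - k] such that [L_1, ...,
   L_k] and [l] have no common zero in [P^n] ([k = h - 1]).

   This goes by induction on [k]. Given such an [l] for [k], choose [n + 1] points [y_j] in the
   target of [l] which impose independent conditions on forms of degree [k + 1]. If for some [j]
   the system [L_1 = ... = L_(k+1) = 0], [l] proportional to [y_j] has no solution, the linear forms
   vanishing on [y_j], composed with [l], do the job. Otherwise it has a solution [x_j] for each [j];
   [x_j] is algebraic over the coefficients of [L_1, ..., L_k], and the [n + 1] equations
   [L_(k+1) (x_j) = 0] express [n + 1] coefficients of [L_(k+1)] through the [x_j] and the other
   coefficients. Together with [L_0 = F (p) = 0] this makes all the coefficients of [F] algebraic over
   one parameter fewer than their number, although [p] contributes [n + 1] parameters; so they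
   satisfy a fixed polynomial relation.

   The algebraic tools are a counting argument for algebraic dependence that applies to functions
   on an arbitrary set (no function field is needed) and the projective Nullstellensatz; they also
   give the two bounds on the lengths of chains of irreducible closed sets. *)

Set Implicit Arguments.
Unset Strict Implicit.
Unset Printing Implicit Defensive.

Import Order.TTheory GRing.Theory Num.Theory.
Local Open Scope ring_scope.

(** * Evaluation of polynomials *)

Section Evaluation.
Variable K : numFieldType.

Lemma digits_inj n D (f g : 'I_n -> nat) :
    (forall i, f i < D)%N -> (forall i, g i < D)%N ->
  (\sum_(i < n) f i * D ^ i = \sum_(i < n) g i * D ^ i)%N -> f =1 g.
Proof.
elim: n f g => [|n IH] f g hf hg; first by move=> _ [].
rewrite !big_ord_recl /= !expn0 !muln1.
have split (u : 'I_n.+1 -> nat) : (\sum_(i < n) u (lift ord0 i) * D ^ (bump 0 i) =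
   (\sum_(i < n) u (lift ord0 i) * D ^ i) * D)%N.
  by rewrite big_distrl; apply: eq_bigr => i _; rewrite /bump /= add1n expnSr mulnA.
rewrite !split => e.
have e0 : f ord0 = g ord0.
  by move/(congr1 (modn^~ D)): (e); rewrite /= ![(_ + _ * D)%N]addnC !modnMDl !modn_small.
have D0 : (0 < D)%N by apply: leq_ltn_trans (hf ord0).
have /IH h : (\sum_(i < n) f (lift ord0 i) * D ^ i = \sum_(i < n) g (lift ord0 i) * D ^ i)%N.
  by move: e; rewrite e0 => /addnI/eqP; rewrite eqn_pmul2r // => /eqP.
move=> i; case: (unliftP ord0 i) => [j|] -> //.
exact: (h (fun i => hf _) (fun i => hg _)).
Qed.

(** In characteristic zero the natural numbers are distinct, so a nonzero difference would have more
    roots than its size allows. *)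
Lemma poly_ext (p q : {poly K}) : (forall x, p.[x] = q.[x]) -> p = q.
Proof.
move=> h; apply/eqP; rewrite -subr_eq0; apply/negPn/negP => nz.
pose s : seq K := [seq i%:R | i <- iota 0 (size (p - q))].
have hr : all (root (p - q)) s by apply/allP => x _; rewrite /root hornerD hornerN h subrr.
have us : uniq s by rewrite map_inj_uniq ?iota_uniq // => i j /eqP; rewrite eqr_nat => /eqP.
by have := max_poly_roots nz hr us; rewrite size_map size_iota ltnn.
Qed.

(* Kronecker substitution: [v i = t ^ (D ^ i)] separates the monomials of [p]. *)
Lemma meval_eq0 n (p : {mpoly K[n]}) : (forall v, p.@[v] = 0) -> p = 0.
Proof.
move=> h; pose D := msize p; pose kr (m : 'X_{1..n}) := (\sum_(i < n) m i * D ^ i)%N.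
have hD m (i : 'I_n) : m \in msupp p -> (m i < D)%N.
  move=> hm; apply: leq_ltn_trans (msize_mdeg_lt hm).
  by rewrite mdegE (bigD1 i) //= leq_addr.
have q0 : \sum_(m <- msupp p) p@_m *: 'X^(kr m) = 0 :> {poly K}.
  apply: poly_ext => t; rewrite horner0 -(h (fun i => t ^+ (D ^ i))) mevalE horner_sum.
  apply: eq_bigr => m _; rewrite hornerZ hornerXn; congr (_ * _).
  rewrite /kr -prodrXr; apply: eq_bigr => i _.
  by rewrite -exprM mulnC.
apply/mpolyP => m; rewrite mcoeff0; apply/eqP/negPn/negP => nz.
have hm : m \in msupp p by rewrite mcoeff_msupp.
move/(congr1 (fun q : {poly K} => q`_(kr m))): q0; rewrite coef0 coef_sum.
rewrite (bigD1_seq m) ?msupp_uniq //= coefZ coefXn eqxx mulr1 big1_seq ?addr0.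
  by move/eqP; rewrite (negPf nz).
move=> m' /andP[ne hm']; rewrite coefZ coefXn; case: eqP => [e|]; last by rewrite mulr0.
case/eqP: ne; apply/mnmP => i.
by apply: esym; apply: (digits_inj _ _ e) => j; apply: hD.
Qed.

Lemma mpoly_ext n (p q : {mpoly K[n]}) : (forall v, p.@[v] = q.@[v]) -> p = q.
Proof.
move=> h; apply/eqP; rewrite -subr_eq0; apply/eqP/meval_eq0 => v.
by rewrite mevalB h subrr.
Qed.

End Evaluation.

Lemma meval_homog (K : comNzRingType) n d (p : {mpoly K[n]}) t v :
  p \is d.-homog -> p.@[fun i => t * v i] = t ^+ d * p.@[v].
Proof.
move=> /dhomogP hp; rewrite !mevalE big_distrr big_seq [RHS]big_seq.
apply: eq_bigr => m /hp <- /=; rewrite mulrCA; congr (_ * _).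
rewrite -[X in t ^+ X]/(mdeg m) mdegE -prodrXr -big_split; apply: eq_bigr => i _.
exact: exprMn.
Qed.

Lemma prod_homog (K : comNzRingType) n (I : Type) (r : seq I) (P : pred I)
    (F : I -> {mpoly K[n]}) (d : I -> nat) :
  (forall i, P i -> F i \is (d i).-homog) ->
  \prod_(i <- r | P i) F i \is (\sum_(i <- r | P i) d i)%N.-homog.
Proof.
move=> h; elim/big_rec2: _ => [|i p q Pi hq]; first exact: dhomog1.
by rewrite dhomogM // h.
Qed.

Lemma comp_homog (K : comNzRingType) n k d e (p : {mpoly K[n]}) (s : n.-tuple {mpoly K[k]}) :
  p \is d.-homog -> (forall i, tnth s i \is e.-homog) -> p \mPo s \is (e * d)%N.-homog.
Proof.
move=> /dhomogP hp hs; rewrite comp_mpolyEX big_seq rpred_sum // => m /hp <-.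
rewrite rpredZ // comp_mpolyX -[X in (e * X)%N]/(mdeg m) mdegE big_distrr /=.
by apply: prod_homog => i _; rewrite dhomogMn.
Qed.

(** Along the line through [v], the values of [p] form a polynomial in [t] whose coefficients are
    the values at [v] of the homogeneous parts. *)
Lemma pihomog_eval0 (K : numFieldType) n (p : {mpoly K[n]}) v :
  (forall t, t != 0 -> p.@[fun i => t * v i] = 0) ->
  forall d, (pihomog mdeg d p).@[v] = 0.
Proof.
move=> h d.
have e t : p.@[fun i => t * v i] =
    (\sum_(i < msize p) (pihomog mdeg i p).@[v] *: 'X^i : {poly K}).[t].
  rewrite {1}(pihomog_partitionE (leqnn (msize p))) horner_sum raddf_sum.
  apply: eq_bigr => i _ /=; rewrite hornerZ hornerXn (meval_homog _ _ (pihomogP _ _ _)).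
  exact: mulrC.
(* The factor ['X] takes care of [t = 0], where the vanishing of [p] is not given. *)
have q0 : 'X * (\sum_(i < msize p) (pihomog mdeg i p).@[v] *: 'X^i : {poly K}) = 0.
  apply: poly_ext => t; rewrite hornerM hornerX horner0 -e.
  by have [->|/h->] := eqVneq t 0; rewrite ?mul0r ?mulr0.
have [hd|hd] := ltnP d (msize p); last first.
  rewrite pihomogE big_seq_cond big_pred0 ?meval0 // => m.
  apply/negP => /andP[/msize_mdeg_lt + /eqP e']; rewrite ltnNge.
  by move: hd; rewrite -e' => ->.
move/eqP: q0; rewrite mulf_eq0 polyX_eq0 /= => /eqP/(congr1 (fun q : {poly K} => q`_d)).
rewrite coef0 coef_sum (bigD1 (Ordinal hd)) //= coefZ coefXn eqxx mulr1 big1 ?addr0 //.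
move=> i ne; rewrite coefZ coefXn; case: eqP => [e'|]; last by rewrite mulr0.
by case/eqP: ne; apply: val_inj; rewrite /= e'.
Qed.

Lemma mevalXn (K : comNzRingType) n (p : {mpoly K[n]}) v k : (p ^+ k).@[v] = p.@[v] ^+ k.
Proof. exact: rmorphXn. Qed.

Lemma meval_prod (K : comNzRingType) n (I : Type) (r : seq I) (P : pred I)
    (F : I -> {mpoly K[n]}) v :
  (\prod_(i <- r | P i) F i).@[v] = \prod_(i <- r | P i) (F i).@[v].
Proof. exact: rmorph_prod. Qed.

Lemma meval_sum (K : comNzRingType) n (I : Type) (r : seq I) (P : pred I)
    (F : I -> {mpoly K[n]}) v :
  (\sum_(i <- r | P i) F i).@[v] = \sum_(i <- r | P i) (F i).@[v].
Proof. exact: raddf_sum. Qed.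

Lemma linear_dependency (K : fieldType) (I T : finType) (G : I -> T -> K) :
  (#|T| < #|I|)%N -> exists2 u : I -> K, exists i, u i != 0 & forall t, \sum_i u i * G i t = 0.
Proof.
move=> hc; pose A := \matrix_(i < #|I|, j < #|T|) G (enum_val i) (enum_val j).
have kA : kermx A != 0.
  rewrite kermx_eq0 -row_leq_rank -ltnNge; apply: leq_ltn_trans hc; exact: rank_leq_col.
case/rowV0Pn: kA => v /sub_kermxP vA v0.
exists (fun i => v 0 (enum_rank i)).
  by have /rV0Pn[j hj] := v0; exists (enum_val j); rewrite enum_valK.
move=> t; move/matrixP/(_ 0 (enum_rank t)): vA; rewrite !mxE => e; rewrite -[RHS]e.
rewrite [RHS](reindex_onto enum_rank enum_val) => [|j _]; last exact: enum_valK.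
by apply: eq_big => [i|i _]; rewrite ?enum_rankK ?eqxx // mxE !enum_rankK.
Qed.

(** * Noetherianity *)

Section Noetherian.

Lemma nondecreasing_subsequence (u : nat -> nat) :
  exists f : nat -> nat, {homo f : i j / (i < j)%N} /\ {homo (u \o f) : i j / (i <= j)%N}.
Proof.
(* Every tail has an index at which [u] is minimal on that tail; iterating this choice gives the
   subsequence. *)
have hmin k : exists a, (k <= a)%N /\ forall b, (k <= b)%N -> (u a <= u b)%N.
  have ex : exists v, `[< exists2 b, (k <= b)%N & u b = v >].
    by exists (u k); apply/asboolP; exists k.
  case: (ex_minnP ex) => v /asboolP[a ka <-] hm; exists a; split=> // b kb.
  by apply: hm; apply/asboolP; exists b.
have [a ha] := choice hmin.
pose f := fix f i := if i is i'.+1 then a (f i').+1 else a 0%N.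
have f1 i : (f i < f i.+1)%N by have [] := ha (f i).+1.
exists f; split; first exact: homo_ltn ltn_trans f1.
apply: homo_leq => [x|x y z|i] //; first exact: leq_trans.
rewrite /=; case: i => [|i] /=; first by have [_] := ha 0%N; apply.
by have [_] := ha (f i).+1; apply; apply: ltn_trans (f1 i) (f1 i.+1).
Qed.

(** Passing to subsequences, one coordinate after the other, makes all exponents nondecreasing; the
    first two terms then compare. *)
Lemma dickson n (u : nat -> 'X_{1..n}) : exists i j, (i < j)%N /\ (u i <= u j)%MM.
Proof.
have [f hf hu] : exists2 f : nat -> nat, {homo f : i j / (i < j)%N} &
    forall c, c \in enum 'I_n -> {homo (fun i => u (f i) c) : i j / (i <= j)%N}.
  elim: (enum 'I_n) => [|c s [f hf hu]]; first by exists id.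
  have [g [hg hug]] := nondecreasing_subsequence (fun i => u (f i) c).
  exists (f \o g) => [i j ij|c']; first by apply/hf/hg.
  rewrite inE => /orP[/eqP->//|cs] i j ij; apply: hu => //.
  by move: ij; rewrite leq_eqVlt => /orP[/eqP->//|/hg/ltnW].
exists (f 0%N), (f 1%N); split; first exact: hf.
by apply/mnm_lepP => c; apply: hu; rewrite ?mem_enum.
Qed.

(* Choose [g i] in [J i.+1] outside [J i] with minimal leading monomial and reduce it by Dickson. *)
Lemma no_increasing_ideals (K : fieldType) n (J : nat -> {mpoly K[n]} -> Prop) :
    (forall i, J i 0) -> (forall i p q, J i p -> J i q -> J i (p + q)) ->
    (forall i p q, J i p -> J i (q * p)) ->
    (forall i p, J i p -> J i.+1 p) ->
  ~ (forall i, exists g, J i.+1 g /\ ~ J i g).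
Proof.
move=> J0 JD JM JS Jlt.
have hmin i : exists g, [/\ J i.+1 g, ~ J i g &
    forall g', J i.+1 g' -> ~ J i g' -> ~ (mlead g' < mlead g)%O].
  have [g hg] := Jlt i; move: {-1}(mlead g) (erefl (mlead g)) => m.
  elim/(well_founded_ind (@ltom_wf n)): m => m IH in g hg *; move=> em.
  case: (pselect (exists g', [/\ J i.+1 g', ~ J i g' & (mlead g' < mlead g)%O])).
    by case=> g' [h1 h2 h3]; apply: (IH (mlead g') _ g') => //; rewrite -em.
  by move=> h; exists g; case: hg => h1 h2; split=> // g' h3 h4 h5; apply: h; exists g'.
have [g hg] := choice hmin.
have [i [j [ij hij]]] := dickson (fun i => mlead (g i)).
have mono a b p : (a <= b)%N -> J a p -> J b p.
  by move=> /subnK <-; elim: (b - a)%N => //= k IH /IH; apply: JS.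
have [h1 h2 h3] := hg j; have [h1' h2' _] := hg i.
have gi0 : g i != 0 by apply/negP => /eqP e; apply: h2'; rewrite e.
have gj0 : g j != 0 by apply/negP => /eqP e; apply: h2; rewrite e.
pose c := mleadc (g j) / mleadc (g i).
pose r := g j - c *: 'X_[mlead (g j) - mlead (g i)] * g i.
have lq : mlead (c *: 'X_[mlead (g j) - mlead (g i)] * g i) = mlead (g j).
  have c0 : c != 0 by rewrite mulf_neq0 ?invr_eq0 ?mleadc_eq0.
  by rewrite mleadM ?scaler_eq0 ?negb_or ?c0 //= ?mleadZ // ?mleadXm ?submK // -msize_poly_eq0 msizeX.
have rJ : ~ J j r.
  move=> hr; apply: h2; rewrite -(subrK (c *: 'X_[mlead (g j) - mlead (g i)] * g i) (g j)).
  by apply: (JD _ _ _ hr); apply: JM; apply: mono h1'.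
have r0 : r != 0 by apply/negP => /eqP e; apply: rJ; rewrite e.
apply: (h3 r) => //.
  by apply: JD => //; rewrite -mulNr; apply: JM; apply: JS; apply: mono h1'.
(* The leading monomial of [r] is at most that of [g j], and differs from it because [c] cancels the
   leading coefficients: this contradicts the minimality of [g j]. *)
rewrite lt_neqAle; apply/andP; split; last first.
  by apply: le_trans (mleadB_le _ _) _; rewrite lq joinxx.
apply/negP => /eqP e; move: r0; rewrite -mleadc_eq0 e /r mcoeffB -scalerAl mcoeffZ.
rewrite [X in _ * X](_ : _ = mleadc (g i)); last first.
  by rewrite mulrC -[X in _@_X](submK hij) mcoeffMX.
by rewrite /c divfK ?subrr ?eqxx ?mleadc_eq0.
Qed.

Lemma no_decreasing_zeros (K : fieldType) n (Z : nat -> set ('I_n -> K)) :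
    (forall i, Z i.+1 `<=` Z i)%classic ->
  ~ (forall i, exists p : {mpoly K[n]},
       (forall v, Z i.+1 v -> p.@[v] = 0) /\ ~ (forall v, Z i v -> p.@[v] = 0)).
Proof.
move=> hZ; apply: (no_increasing_ideals (J := fun i p => forall v, Z i v -> p.@[v] = 0)).
- by move=> i v _; rewrite meval0.
- by move=> i p q hp hq v Zv; rewrite mevalD hp ?hq ?addr0.
- by move=> i p q hp v Zv; rewrite mevalM hp ?mulr0.
- by move=> i p hp v /hZ/hp.
Qed.

(** A form of Hilbert's basis theorem: otherwise one can forever add a member of [S] that is nonzero
    at some common zero of the previous ones, and the zero loci never stop shrinking. *)
Lemma finite_zeros (K : fieldType) n (S : set {mpoly K[n]}) :
  exists s : seq {mpoly K[n]}, (forall p, p \in s -> S p) /\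
    forall v, (forall p, p \in s -> p.@[v] = 0) -> forall p, S p -> p.@[v] = 0.
Proof.
apply: contrapT => hS.
have step (s : seq {mpoly K[n]}) : exists p, (forall q, q \in s -> S q) ->
    S p /\ exists v, (forall q, q \in s -> q.@[v] = 0) /\ p.@[v] <> 0.
  apply: contrapT => h; apply: hS; exists s.
  have hs : forall q, q \in s -> S q.
    by apply: contrapT => h'; apply: h; exists 0 => hs; case: h'.
  split=> // v hv p Sp; apply: contrapT => pv; apply: h; exists p => _.
  by split=> //; exists v.
have [f hf] := choice step.
pose s := fix s i := if i is i'.+1 then f (s i') :: s i' else [::].
have hs i : forall q, q \in s i -> S q.
  elim: i => [|i IH] q //=; rewrite inE => /orP[/eqP->|/IH//].
  by have [] := hf _ IH.
apply: (@no_decreasing_zeros K n (fun i v => forall p, p \in s i -> p.@[v] = 0)).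
  by move=> i v hv p ps; apply: hv; rewrite /= inE ps orbT.
move=> i; exists (f (s i)); split; first by move=> v; apply; rewrite /= mem_head.
have [_ [v [hv nz]]] := hf _ (hs i).
by move=> h; apply: nz; apply: h.
Qed.

End Noetherian.

(** * Projective Nullstellensatz *)

Section Nullstellensatz.
Variables (K : numClosedFieldType) (n : nat).
Implicit Types (p q l : {mpoly K[n]}) (I J : nat -> {mpoly K[n]} -> Prop).

(** An ideal is given by its homogeneous elements, [I e] being its part of degree [e]. *)
Record graded_ideal I : Prop := GradedIdeal {
  gi_homog : forall e p, I e p -> p \is e.-homog;
  gi0 : forall e, I e 0;
  giD : forall e p q, I e p -> I e q -> I e (p + q);
  giM : forall k e q p, q \is k.-homog -> I e p -> I (k + e)%N (q * p) }.

Definition full I e := forall p, p \is e.-homog -> I e p.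

(** The part of degree [e] of the ideal generated by [I] and a linear form [l]; in degree 0 there is
    no multiple of [l] to add. *)
Definition add_linear I l e p :=
  exists v q, [/\ I e v, (if e is e'.+1 then q \is e'.-homog else q == 0) & p = v + q * l].

Lemma const_homog c : c%:MP \is [in K[n], 0.-homog].
Proof. by rewrite -alg_mpolyC rpredZ ?dhomog1. Qed.

Lemma var_homog i : 'X_i \is [in K[n], 1.-homog].
Proof. by rewrite dhomogX /= mdeg1. Qed.

Lemma giZ I c e p : graded_ideal I -> I e p -> I e (c *: p).
Proof. by move=> hI; rewrite -mul_mpolyC; apply: (giM hI (const_homog c)). Qed.

Lemma giB I e p q : graded_ideal I -> I e p -> I e q -> I e (p - q).
Proof. by move=> hI hp hq; rewrite -scaleN1r; apply: giD => //; apply: giZ. Qed.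

Lemma gi_sum I (T : eqType) (r : seq T) e (F : T -> {mpoly K[n]}) :
  graded_ideal I -> (forall i, i \in r -> I e (F i)) -> I e (\sum_(i <- r) F i).
Proof.
move=> hI hF; rewrite big_seq; elim/big_ind: _ => //; first exact: gi0.
by move=> p q; apply: giD.
Qed.

Lemma mnm_pos (m : 'X_{1..n}) e : mdeg m = e.+1 -> exists i m', m = (U_(i) + m')%MM /\ mdeg m' = e.
Proof.
move=> hm; have [i hi] : exists i, m i != 0%N.
  apply: contrapT => h; move: hm; rewrite mdegE big1 // => i _.
  by apply: contrapT => h'; apply: h; exists i; apply/eqP.
exists i, (m - U_(i))%MM; have e' : m = (U_(i) + (m - U_(i)))%MM.
  by rewrite addmC submK // lep1mP.
by split=> //; move: hm; rewrite {1}e' mdegD mdeg1 => -[].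
Qed.

Lemma fullD I k e : graded_ideal I -> full I e -> full I (k + e)%N.
Proof.
move=> hI; elim: k => [|k IH] // hf p /dhomogP hp.
rewrite (mpolyE p); apply: gi_sum => // m hm; apply: giZ => //.
have [i [m' [-> hm']]] := mnm_pos (hp m hm).
rewrite mpolyXD; apply: (@giM _ hI 1); first exact: var_homog.
by apply: IH => //; rewrite dhomogX; apply/eqP.
Qed.

Lemma add_linear_ideal I l : graded_ideal I -> l \is 1.-homog -> graded_ideal (add_linear I l).
Proof.
move=> hI hl; split.
- move=> e p [v [q [hv hq ->]]]; rewrite rpredD //; first exact: gi_homog hv.
  case: e hq {hv} => [/eqP->|e hq]; first by rewrite mul0r rpred0.
  by rewrite -addn1 dhomogM.
- move=> e; exists 0, 0; rewrite mul0r addr0; split=> //; first exact: gi0.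
  by case: e => //= e; rewrite rpred0.
- move=> e _ _ [v [q [hv hq ->]]] [v' [q' [hv' hq' ->]]].
  exists (v + v'), (q + q'); rewrite mulrDl addrACA; split=> //; first exact: giD.
  case: e hq hq' {hv hv'} => [/eqP-> /eqP->|e hq hq']; first by rewrite addr0.
  by rewrite rpredD.
- move=> k e r _ hr [v [q [hv hq ->]]].
  exists (r * v), (r * q); rewrite mulrDr mulrA; split=> //; first exact: giM.
  case: e hq {hv} => [/eqP->|e hq]; last by rewrite addnS dhomogM.
  by rewrite mulr0 addn0; case: k {hr} => //= k; rewrite rpred0.
Qed.

Lemma add_linear_sub I l e p : I e p -> add_linear I l e p.
Proof.
move=> hp; exists p, 0; rewrite mul0r addr0; split=> //.
by case: e {hp} => //= e; rewrite rpred0.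
Qed.

Lemma add_linear_mem I l : graded_ideal I -> add_linear I l 1 l.
Proof.
by move=> hI; exists 0, 1; rewrite mul1r add0r; split=> //; [apply: gi0 | apply: dhomog1].
Qed.

(** Factors [l] are split off one at a time. In high degree, the quotient by [I] is thus generated
    over [K[l]] by the forms of degree [e]. *)
Lemma full_pow I l e m p : graded_ideal I -> l \is 1.-homog -> full (add_linear I l) e ->
  p \is (m + e)%N.-homog -> exists2 g, g \is e.-homog & I (m + e)%N (p - l ^+ m * g).
Proof.
move=> hI hl hf; elim: m p => [|m IH] p hp.
  by exists p => //; rewrite expr0 mul1r subrr; apply: gi0.
have [v [q [hv hq ->]]] := @fullD _ m.+1 _ (add_linear_ideal hI hl) hf p hp.
have [g hg hIg] := IH q hq; exists g => //.
rewrite (_ : _ - _ = v + l * (q - l ^+ m * g)); last by rewrite exprS; ring.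
by apply: giD => //; apply: (@giM _ hI 1).
Qed.

(** The linear factors are split off one after the other. Consequently, if their product lies in
    [I], then [I] contains all forms of high degree. *)
Lemma full_prod I (L : seq {mpoly K[n]}) : graded_ideal I ->
    (forall l, l \in L -> l \is 1.-homog /\ exists e, full (add_linear I l) e) ->
  exists E0, forall E p, (E0 <= E)%N -> p \is (size L + E)%N.-homog ->
    exists2 q, q \is E.-homog & I (size L + E)%N (p - q * \prod_(l <- L) l).
Proof.
move=> hI; elim: L => [|l L IH] hL.
  by exists 0%N => E p _ hp; exists p => //; rewrite big_nil mulr1 subrr; apply: gi0.
have [l1 L1] := (hL _ (mem_head _ _), fun l' h => hL l' (mem_behead (s := l :: L) h)).
have [E0 hE0] := IH L1; case: l1 => hl [e he].
exists (maxn E0 e) => E p; rewrite geq_max => /andP[h0 h1] hp.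
have [|q hq hIq] := hE0 E.+1 p (leqW h0); first by rewrite addnS.
have := @fullD _ (E.+1 - e) _ (add_linear_ideal hI hl) he; rewrite subnK ?(leqW h1) // => /(_ _ hq).
case=> v [q' [hv hq' eq]]; exists q' => //.
rewrite big_cons addSn -addnS.
rewrite (_ : _ - _ = (p - q * \prod_(l' <- L) l') + (\prod_(l' <- L) l') * v).
  apply: giD => //; apply: giM => //.
  rewrite -/(size L) -sum1_size !big_seq; apply: prod_homog => l' /L1[].
  done.
by rewrite eq; ring.
Qed.

(** The left-hand side is the homogenization of [u] in degree [M]: the roots of [u] give linear
    factors, and the gap between [M] and the degree of [u] gives a power of [a]. *)
Lemma binary_form_factor (a b : {mpoly K[n]}) M (u : {poly K}) : (size u <= M.+1)%N ->
  u != 0 -> exists r : seq K, (size r <= M)%N /\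
  \sum_(s < M.+1) u`_s *: (b ^+ s * a ^+ (M - s)) =
  lead_coef u *: (a ^+ (M - size r) * \prod_(z <- r) (b - z *: a)).
Proof.
move=> su u0; have [r er] := closed_field_poly_normal u.
have sr : size u = (size r).+1.
  by rewrite er size_scale ?lead_coef_eq0 // size_prod_XsubC.
exists r; split; first by rewrite -ltnS -sr.
apply: mpoly_ext => v; rewrite mevalZ mevalM mevalXn meval_prod meval_sum /=.
have -> : \prod_(z <- r) (b - z *: a).@[v] = \prod_(z <- r) (b.@[v] - z * a.@[v]).
  by apply: eq_bigr => z _; rewrite mevalB mevalZ.
have -> : \sum_(s < M.+1) (u`_s *: (b ^+ s * a ^+ (M - s))).@[v] =
   \sum_(s < M.+1) u`_s * (b.@[v] ^+ s * a.@[v] ^+ (M - s)).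
  by apply: eq_bigr => s _; rewrite mevalZ mevalM !mevalXn.
move: b.@[v] a.@[v] => {v a b} y x.
(* Where [a] vanishes one cannot dehomogenize, but only the term [s = M] survives. *)
have [->|x0] := eqVneq x 0.
  rewrite big_ord_recr /= subnn mulr1 big1 ?add0r; last first.
    by move=> i _; rewrite expr0n subn_eq0 leqNgt ltn_ord /= !mulr0.
  move: su; rewrite sr ltnS leq_eqVlt => /orP[/eqP e|lt].
    rewrite -e subnn expr0 mul1r; congr (_ * _); first by rewrite lead_coefE sr.
    rewrite (eq_bigr (fun=> y)) => [|z _]; last by rewrite mulr0 subr0.
    by rewrite big_const_seq count_predT iter_mulr_1.
  rewrite nth_default ?mul0r; last by rewrite sr.
  by rewrite expr0n subn_eq0 leqNgt lt /= mul0r mulr0.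
have -> : \sum_(s < M.+1) u`_s * (y ^+ s * x ^+ (M - s)) = x ^+ M * u.[y / x].
  rewrite (horner_coef_wide _ su) big_distrr; apply: eq_bigr => s _ /=.
  have sM : (s <= M)%N by rewrite -ltnS.
  have -> : x ^+ M = x ^+ (M - s) * x ^+ s by rewrite -exprD subnK.
  by rewrite expr_div_n; field; rewrite expf_neq0.
rewrite {1}er hornerZ horner_prod mulrCA; congr (_ * _).
have sM : (size r <= M)%N by rewrite -ltnS -sr.
rewrite -{1}(subnK sM) exprD -mulrA; congr (_ * _).
elim: r {er sr sM} => [|z r IH]; first by rewrite !big_nil expr0 mulr1.
rewrite !big_cons -IH /= exprS hornerD hornerN hornerX hornerC.
set P := \prod_(_ <- r) _; move: P (x ^+ _) => P X.
by field.
Qed.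

Definition relevant I := forall e, ~ full I e.

(* Otherwise [S/I] is a finite module over [K[a]], so some nonzero binary form in [a] and [b] lies in
   [I]. It splits into linear forms [l]; as each [I + (l)] contains all forms of high degree, so
   does [I]. *)
Lemma relevant_add_linear I (a b : {mpoly K[n]}) : graded_ideal I -> relevant I ->
    a \is 1.-homog -> b \is 1.-homog ->
  exists x y : K, (x != 0) || (y != 0) /\ relevant (add_linear I (x *: a + y *: b)).
Proof.
move=> hI rI ha hb.
case: (pselect (relevant (add_linear I a))) => [h|nra].
  by exists 1, 0; rewrite oner_eq0 scale1r scale0r addr0.
apply: contrapT => hno.
have hfull x y : (x != 0) || (y != 0) -> exists e, full (add_linear I (x *: a + y *: b)) e.
  move=> xy; apply: contrapT => h; apply: hno; exists x, y; split=> // e he; apply: h.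
  by exists e.
have [e he] : exists e, full (add_linear I a) e.
  by have := hfull 1 0; rewrite oner_eq0 scale1r scale0r addr0; apply.
(* Modulo [I], each of the [M + 1] products of powers of [b] and [a] is [a ^+ m] times a form [g s]
   of degree [e]. Such a form has at most [m] coefficients, and [m <= M], so the [g s] are linearly
   dependent. *)
pose m := #|{: 'X_{1..n < e.+1}}|; pose M := (m + e)%N.
have hp (s : 'I_M.+1) : b ^+ s * a ^+ (M - s) \is M.-homog.
  have sM : (s <= M)%N by rewrite -ltnS.
  by rewrite -[X in X.-homog](subnKC sM) dhomogM //;
     [have := dhomogMn s hb | have := dhomogMn (M - s) ha]; rewrite mul1n.
have [g hg] := choice (fun s => (let: ex_intro2 g h1 h2 := full_pow hI ha he (hp s) in
   ex_intro (fun g => g \is e.-homog /\ I M (b ^+ s * a ^+ (M - s) - a ^+ m * g)) g (conj h1 h2))).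
have [|u [i ui0] hu] := linear_dependency (I := 'I_M.+1) (T := 'X_{1..n < e.+1})
    (fun s t => (g s)@_t).
  by rewrite card_ord ltnS leq_addr.
have gu : \sum_s u s *: g s = 0.
  apply/mpolyP => t; rewrite mcoeff0 raddf_sum /=.
  have [ht|ht] := ltnP (mdeg t) e.+1.
    by rewrite -[RHS](hu (BMultinom ht)); apply: eq_bigr => s _; rewrite mcoeffZ.
  rewrite big1 // => s _; rewrite mcoeffZ (dhomog_nemf_coeff (proj1 (hg s))) ?mulr0 //=.
  by rewrite gtn_eqF.
pose P := \poly_(s < M.+1) u (inord s).
have Ps (s : 'I_M.+1) : P`_s = u s by rewrite coef_poly ltn_ord inord_val.
have P0 : P != 0 by apply/negP => /eqP e0; move: ui0; rewrite -Ps e0 coef0 eqxx.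
have [r [hr er]] := binary_form_factor a b (size_poly _ _ : size P <= M.+1)%N P0.
have IM : I M (a ^+ (M - size r) * \prod_(z <- r) (b - z *: a)).
  rewrite -[X in I M X]scale1r -(mulVf (_ : lead_coef P != 0)) ?lead_coef_eq0 //.
  rewrite -scalerA -er; apply: giZ => //.
  have -> : \sum_(s < M.+1) P`_s *: (b ^+ s * a ^+ (M - s)) =
     \sum_(s < M.+1) u s *: (b ^+ s * a ^+ (M - s) - a ^+ m * g s).
    rewrite [RHS](eq_bigr (fun s : 'I_M.+1 => u s *: (b ^+ s * a ^+ (M - s)) - a ^+ m * (u s *: g s))).
      rewrite sumrB -big_distrr /= gu mulr0 subr0.
      by apply: eq_bigr => s _; rewrite Ps.
    by move=> s _; rewrite scalerBr -scalerAr.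
  by apply: gi_sum => // s _; apply: giZ => //; have [] := hg s.
pose L := nseq (M - size r) a ++ [seq b - z *: a | z <- r].
have [|E0 hE] := @full_prod I L hI.
  move=> l; rewrite mem_cat => /orP[/nseqP[-> _]|/mapP[z _ ->]].
    by split=> //; exists e.
  split; first by rewrite rpredB // rpredZ.
  by have := hfull (- z) 1; rewrite oner_eq0 orbT scale1r scaleNr addrC; apply.
apply: (rI (size L + E0)%N) => p /hE[] // q hq.
have -> : \prod_(l <- L) l = a ^+ (M - size r) * \prod_(z <- r) (b - z *: a).
  by rewrite big_cat big_map big_nseq iter_mulr_1.
have sL : size L = M by rewrite size_cat size_nseq size_map subnK.
move=> h; rewrite -[p](subrK (q * (a ^+ (M - size r) * \prod_(z <- r) (b - z *: a)))).
by apply: giD => //; rewrite sL addnC; apply: giM.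
Qed.

(** For each coordinate in turn, add a combination [x *: l + y *: 'X_i] that keeps the ideal
    relevant. In the end the coordinates are proportional modulo [J], so that [J] describes a single
    point. *)
Lemma relevant_coordinates I (s : seq 'I_n) : graded_ideal I -> relevant I ->
  exists J l (c : 'I_n -> K), [/\ graded_ideal J, relevant J, (forall e p, I e p -> J e p),
    l \is 1.-homog & forall i, i \in s -> J 1 ('X_i - c i *: l)].
Proof.
move=> hI rI; elim: s => [|i s [J [l [c [hJ rJ IJ hl hc]]]]].
  by exists I, 0, (fun=> 0); split=> //; apply: rpred0.
have [x [y [xy hr]]] := relevant_add_linear hJ rJ hl (var_homog i).
have hxy : x *: l + y *: 'X_i \is [in K[n], 1.-homog].
  by rewrite rpredD ?rpredZ ?var_homog.
have hJ' := add_linear_ideal hJ hxy.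
have JJ' e p : J e p -> add_linear J (x *: l + y *: 'X_i) e p by apply: add_linear_sub.
(* If [y = 0], then [l] enters the ideal, the coordinates treated so far follow it, and ['X_i] takes
   the place of [l]. *)
have [y0|y0] := eqVneq y 0.
  move: xy; rewrite y0 eqxx orbF => x0.
  have lJ : add_linear J (x *: l + y *: 'X_i) 1 l.
    rewrite -[X in add_linear _ _ _ X](scalerK x0); apply: giZ => //.
    by have := add_linear_mem (x *: l + y *: 'X_i) hJ; rewrite {2}y0 scale0r addr0.
  exists (add_linear J (x *: l + y *: 'X_i)), 'X_i, (fun j => (j == i)%:R).
  split=> //; [by move=> e p /IJ/JJ' | exact: var_homog|] => j; rewrite inE.
  have [->|_ /= /hc/JJ'] := eqVneq j i; first by rewrite scale1r subrr; move=> _; apply: gi0.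
  rewrite scale0r subr0 => h; rewrite -['X_j](subrK (c j *: l)).
  by apply: giD => //; apply: giZ.
exists (add_linear J (x *: l + y *: 'X_i)), l, (fun j => if j == i then - (x / y) else c j).
split=> //; [by move=> e p /IJ/JJ' |] => j; rewrite inE.
have [->|_ /= /hc/JJ'//] := eqVneq j i; move=> _.
rewrite (_ : _ - _ = y^-1 *: (x *: l + y *: 'X_i)); last first.
  by rewrite scalerDr !scalerA mulVf // scale1r scaleNr opprK addrC mulrC.
by apply: giZ => //; apply: add_linear_mem.
Qed.

(** Once all coordinates are multiples of [l] modulo [J], a form [p] of degree [e] is congruent to
    [p.@[c] *: l ^+ e]. A form of [I] that is nonzero at [c] would put [l ^+ e], hence all forms of
    degree [e], into [J]. *)
Lemma projective_nullstellensatz I : graded_ideal I -> relevant I ->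
  exists c : 'I_n -> K, (exists i, c i != 0) /\ forall e p, I e p -> p.@[c] = 0.
Proof.
move=> hI rI; have [J [l [c [hJ rJ IJ hl hc]]]] := relevant_coordinates (enum 'I_n) hI rI.
have {}hc i : J 1 ('X_i - c i *: l) by apply: hc; rewrite mem_enum.
have hl' k : l ^+ k \is k.-homog by have := dhomogMn k hl; rewrite mul1n.
have hX e (m : 'X_{1..n}) : mdeg m = e -> J e ('X_[m] - ('X_[m]).@[c] *: l ^+ e).
  elim: e m => [|e IH] m hm.
    move/eqP: hm; rewrite mdeg_eq0 => /eqP->.
    by rewrite mpolyX0 meval1 expr0 scale1r subrr; apply: gi0.
  have [i [m' [-> /IH hm']]] := mnm_pos hm; rewrite mpolyXD mevalM mevalXU.
  rewrite (_ : _ - _ = 'X_i * ('X_[m'] - ('X_[m']).@[c] *: l ^+ e) +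
     (('X_[m']).@[c] *: l ^+ e) * ('X_i - c i *: l)).
    apply: giD => //; first by apply: (@giM _ hJ 1) => //; apply: var_homog.
    by rewrite -[e.+1]addn1; apply: giM => //; apply: rpredZ; apply: hl'.
  by rewrite exprS -!mul_mpolyC !rmorphM /=; ring.
have hp e p : p \is e.-homog -> J e (p - p.@[c] *: l ^+ e).
  move=> /dhomogP hp; rewrite {1 2}(mpolyE p) meval_sum scaler_suml -sumrB.
  apply: gi_sum => // m /hp hm; rewrite mevalZ -scalerA -scalerBr.
  by apply: giZ => //; apply: hX.
exists c; split.
  apply: contrapT => h; apply: (rJ 1%N) => p h1; have := hp _ _ h1.
  rewrite (_ : p.@[c] = 0) ?scale0r ?subr0 // -(expr1 0) -{1}(mul0r p.@[c]).
  have -> : p.@[c] = p.@[fun i => 0 * c i].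
    apply: meval_eq => i; rewrite mul0r; apply: contrapT => ci; apply: h.
    by exists i; apply/eqP.
  by rewrite (meval_homog 0 c h1) !mul0r.
move=> e p hIp; apply: contrapT => /eqP pc; apply: (rJ e) => q hq.
have lJ : J e (l ^+ e).
  rewrite -[X in J _ X](scalerK pc) -[X in J _ (_ *: X)](subKr p).
  by apply: giZ => //; apply: giB => //; [apply: IJ | apply: hp; apply: gi_homog hIp].
by rewrite -(subrK (q.@[c] *: l ^+ e) q); apply: giD => //; [apply: hp | apply: giZ].
Qed.

End Nullstellensatz.

(** * Algebraic dependence by counting *)

Section Dependence.
Variables (K : fieldType) (B : Type) (m : nat) (z : B -> 'I_m -> K).
Implicit Types (A : set B) (g : B -> K).

Definition polyfun g := exists P : {mpoly K[m]}, forall b, g b = P.@[z b].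

(* [g] acts on the vector [w b] as a matrix with entries in [K[z]][1/R]: an integrality condition
   over the functions [z], with [R] nowhere zero on [A], that needs no domain of functions. *)
Definition eigen_over A (I : finType) (w : B -> I -> K) g :=
  exists (R : {mpoly K[m]}) (M : I -> I -> {mpoly K[m]}), forall b, A b ->
    R.@[z b] != 0 /\ forall i, R.@[z b] * (g b * w b i) = \sum_k (M i k).@[z b] * w b k.

(** The same vector [w], nowhere zero on [A], serves all functions of [F], so that the matrices of
    several functions can be added and multiplied; each function has its own denominator [R]. *)
Definition finite_over A (F : set (B -> K)) :=
  exists (I : finType) (w : B -> I -> K), (forall b, A b -> exists i, w b i != 0) /\
    forall g, F g -> eigen_over A w g.

Section Closure.
Variables (A : set B) (I : finType) (w : B -> I -> K).

Lemma eigen_polyfun g : polyfun g -> eigen_over A w g.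
Proof.
case=> P hP; exists 1, (fun i k => if i == k then P else 0) => b _.
rewrite meval1 oner_eq0; split=> // i; rewrite (bigD1 i) //= eqxx big1 ?addr0 ?mul1r ?hP //.
by move=> k; rewrite eq_sym => /negPf->; rewrite meval0 mul0r.
Qed.

Lemma eigenD g h : eigen_over A w g -> eigen_over A w h -> eigen_over A w (fun b => g b + h b).
Proof.
move=> [R [M hM]] [S [N hN]]; exists (R * S), (fun i k => S * M i k + R * N i k) => b Ab.
have [R0 {}hM] := hM b Ab; have [S0 {}hN] := hN b Ab.
rewrite mevalM mulf_neq0 //; split=> // i.
transitivity (S.@[z b] * (R.@[z b] * (g b * w b i)) + R.@[z b] * (S.@[z b] * (h b * w b i))).
  by ring.
rewrite hM hN !big_distrr -big_split; apply: eq_bigr => k _ /=.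
by rewrite mevalD !mevalM; ring.
Qed.

Lemma eigenM g h : eigen_over A w g -> eigen_over A w h -> eigen_over A w (fun b => g b * h b).
Proof.
move=> [R [M hM]] [S [N hN]]; exists (R * S), (fun i k => \sum_j M i j * N j k) => b Ab.
have [R0 {}hM] := hM b Ab; have [S0 {}hN] := hN b Ab.
rewrite mevalM mulf_neq0 //; split=> // i.
transitivity (S.@[z b] * h b * (R.@[z b] * (g b * w b i))); first by ring.
rewrite hM big_distrr /=.
transitivity (\sum_j \sum_k (M i j).@[z b] * ((N j k).@[z b] * w b k)).
  apply: eq_bigr => j _; rewrite -big_distrr -hN /=; ring.
rewrite exchange_big; apply: eq_bigr => k _ /=; rewrite meval_sum big_distrl.
by apply: eq_bigr => j _; rewrite mevalM mulrA.
Qed.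

Lemma eigen_cst c : eigen_over A w (fun=> c).
Proof. by apply: eigen_polyfun; exists c%:MP => b; rewrite mevalC. Qed.

Lemma eq_eigen g h : g =1 h -> eigen_over A w g -> eigen_over A w h.
Proof. by move=> /funext->. Qed.

Lemma eigen_sum (T : Type) (r : seq T) (P : pred T) (G : T -> B -> K) :
  (forall t, P t -> eigen_over A w (G t)) ->
  eigen_over A w (fun b => \sum_(t <- r | P t) G t b).
Proof.
move=> hG; elim: r => [|t r IH].
  by apply: eq_eigen (eigen_cst 0) => b; rewrite big_nil.
case: (boolP (P t)) => Pt.
  by apply: eq_eigen (eigenD (hG t Pt) IH) => b; rewrite big_cons Pt.
by apply: eq_eigen IH => b; rewrite big_cons (negPf Pt).
Qed.

Lemma eigen_prod (T : Type) (r : seq T) (P : pred T) (G : T -> B -> K) :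
  (forall t, P t -> eigen_over A w (G t)) ->
  eigen_over A w (fun b => \prod_(t <- r | P t) G t b).
Proof.
move=> hG; elim: r => [|t r IH].
  by apply: eq_eigen (eigen_cst 1) => b; rewrite big_nil.
case: (boolP (P t)) => Pt.
  by apply: eq_eigen (eigenM (hG t Pt) IH) => b; rewrite big_cons Pt.
by apply: eq_eigen IH => b; rewrite big_cons (negPf Pt).
Qed.

Lemma eigenX g k : eigen_over A w g -> eigen_over A w (fun b => g b ^+ k).
Proof.
move=> hg; elim: k => [|k IH]; first by apply: eq_eigen (eigen_cst 1) => b; rewrite expr0.
by apply: eq_eigen (eigenM hg IH) => b; rewrite exprS.
Qed.

Lemma eigen_meval n (p : {mpoly K[n]}) (x : B -> 'I_n -> K) :
  (forall i, eigen_over A w (fun b => x b i)) -> eigen_over A w (fun b => p.@[x b]).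
Proof.
move=> hx; apply: eq_eigen (_ : eigen_over A w (fun b => \sum_(a <- msupp p) p@_a * \prod_i x b i ^+ a i)).
  by move=> b; rewrite mevalE.
apply: eigen_sum => a _; apply: eigenM; first exact: eigen_cst.
by apply: eigen_prod => i _; apply: eigenX.
Qed.

End Closure.

(** On the tensor product of the two vectors, the functions of [F] act through the first factor and
    those of [G] through the second. *)
Lemma finite_overU A (F G : set (B -> K)) :
  finite_over A F -> finite_over A G -> finite_over A (F `|` G)%classic.
Proof.
move=> [I [w [w0 hw]]] [J [v [v0 hv]]].
exists (I * J)%type, (fun b ij => w b ij.1 * v b ij.2); split.
  move=> b Ab; have [i hi] := w0 b Ab; have [j hj] := v0 b Ab.
  by exists (i, j); rewrite mulf_neq0.
have swap (f : I * J -> K) : \sum_p f p = \sum_i \sum_j f (i, j).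
  by rewrite pair_big; apply: eq_bigr => -[].
move=> g [/hw|/hv] [R [M hM]].
  exists R, (fun p q => if p.2 == q.2 then M p.1 q.1 else 0) => b Ab.
  have [R0 {}hM] := hM b Ab; split=> // -[i j] /=.
  transitivity ((\sum_k (M i k).@[z b] * w b k) * v b j); first by rewrite -hM; ring.
  rewrite swap big_distrl; apply: eq_bigr => k _ /=.
  rewrite (bigD1 j) //= eqxx big1 ?addr0 ?mulrA // => l.
  by rewrite eq_sym => /negPf->; rewrite meval0 mul0r.
exists R, (fun p q => if p.1 == q.1 then M p.2 q.2 else 0) => b Ab.
have [R0 {}hM] := hM b Ab; split=> // -[i j] /=.
transitivity (w b i * (\sum_k (M j k).@[z b] * v b k)); first by rewrite -hM; ring.
rewrite swap [RHS](bigD1 i) //= [X in _ + X]big1 ?addr0.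
  by rewrite big_distrr; apply: eq_bigr => k _ /=; rewrite eqxx; ring.
move=> l; rewrite eq_sym => /negPf->; rewrite big1 // => k _.
by rewrite meval0 mul0r.
Qed.

Lemma finite_over0 A : finite_over A set0.
Proof.
exists unit, (fun _ _ => 1); split=> // b _; exists tt; exact: oner_neq0.
Qed.

Lemma finite_over_bigcup A (T : Type) (s : seq T) (F : T -> set (B -> K)) :
  (forall t, finite_over A (F t)) ->
  finite_over A [set g | List.Exists (fun t => F t g) s].
Proof.
move=> hF; elim: s => [|t s [I [w [w0 hw]]]].
  have [I [w [w0 hw]]] := finite_over0 A.
  by exists I, w; split=> // g /List.Exists_nil.
have [|I' [w' [w0' hw']]] := finite_overU (hF t) (_ : finite_over A [set g | List.Exists (fun t => F t g) s]).
  by exists I, w.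
exists I', w'; split=> // g hg; apply: hw'.
by inversion hg; [left | right].
Qed.

(** Polynomials in the [m + 1] functions [y] act on [w] through matrices of polynomials in only [m]
    variables, which have fewer coefficients once the degree is large. A combination that acts as
    zero vanishes on [A]. *)
Lemma algebraic_dependence A (F : set (B -> K)) (y : 'I_m.+1 -> B -> K) :
    finite_over A F -> (forall t, F (y t)) ->
  exists2 Phi : {mpoly K[m.+1]}, Phi != 0 & forall b, A b -> Phi.@[fun t => y t b] = 0.
Proof.
move=> [I [w [w0 hw]]] hy.
have /choice[R0 /choice[M0 hM0]] := fun t => hw _ (hy t).
pose R := \prod_t R0 t; pose M t i k := (\prod_(s | s != t) R0 s) * M0 t i k.
have hR b : A b -> R.@[z b] != 0.
  by move=> Ab; rewrite meval_prod; apply/prodf_neq0 => t _; have [] := hM0 t b Ab.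
have hM b t i : A b -> R.@[z b] * (y t b * w b i) = \sum_k (M t i k).@[z b] * w b k.
  move=> Ab; have [_ h] := hM0 t b Ab.
  rewrite /R (bigD1 t) //= mevalM mulrAC mulrC h big_distrr.
  by apply: eq_bigr => k _ /=; rewrite /M mevalM mulrA.
pose C := (msize R + \sum_t \sum_i \sum_k msize (M t i k))%N.
have CR : (msize R <= C.+1)%N by rewrite leqW // leq_addr.
have CM t i k : (msize (M t i k) <= C.+1)%N.
  rewrite leqW // /C (bigD1 t) //= (bigD1 i) //= (bigD1 k) //=.
  by rewrite addnCA -!addnA leq_addr.
have msz (p q : {mpoly K[m]}) a c : (msize p <= a.+1)%N -> (msize q <= c.+1)%N ->
    (msize (p * q) <= (a + c).+1)%N.
  have [->|p0] := eqVneq p 0; first by rewrite mul0r msize0.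
  have [->|q0] := eqVneq q 0; first by rewrite mulr0 msize0.
  by rewrite msizeM //; move: (mmeasure _ p) (mmeasure _ q) => s t; lia.
(* The power [R ^+ S] clears the denominators of a monomial of degree at most [S], and each step
   raises the degree of the entries by at most [C]. *)
have mon S (a : 'X_{1..m.+1}) : (mdeg a <= S)%N -> exists Q : I -> I -> {mpoly K[m]},
    (forall i k, msize (Q i k) <= (S * C).+1)%N /\ forall b i, A b ->
    R.@[z b] ^+ S * (('X_[a]).@[fun t => y t b] * w b i) = \sum_k (Q i k).@[z b] * w b k.
  elim: S a => [|S IH] a.
    rewrite leqn0 mdeg_eq0 => /eqP->; exists (fun i k => (i == k)%:R); split=> [i k|b i Ab].
      by rewrite mul0n; case: (i == k); rewrite ?msize1 ?msize0.
    rewrite mpolyX0 meval1 expr0 !mul1r (bigD1 i) //= eqxx meval1 mul1r big1 ?addr0 //.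
    by move=> k; rewrite eq_sym => /negPf->; rewrite meval0 mul0r.
  rewrite leq_eqVlt => /orP[/eqP/mnm_pos[t [a' [-> e]]]|]; last first.
    rewrite ltnS => /IH[Q [sQ hQ]]; exists (fun i k => R * Q i k); split=> [i k|b i Ab].
      by rewrite mulSn; apply: msz.
    rewrite exprS -mulrA hQ // big_distrr; apply: eq_bigr => k _.
    by rewrite /= mevalM mulrA.
  have [|Q [sQ hQ]] := IH a'; first by rewrite e.
  exists (fun i k => \sum_j Q i j * M t j k); split=> [i k|b i Ab].
    apply: leq_trans (msize_sum _ _ _) _; apply/bigmax_leqP => j _.
    by rewrite mulSn addnC; apply: msz.
  rewrite mpolyXD mevalM mevalXU.
  transitivity (R.@[z b] * y t b * (R.@[z b] ^+ S * (('X_[a']).@[fun t => y t b] * w b i))).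
    by rewrite exprS; ring.
  rewrite hQ // big_distrr /=.
  transitivity (\sum_j \sum_k (Q i j).@[z b] * ((M t j k).@[z b] * w b k)).
    apply: eq_bigr => j _; rewrite -big_distrr -hM //=; ring.
  rewrite exchange_big; apply: eq_bigr => k _ /=; rewrite meval_sum big_distrl.
  by apply: eq_bigr => j _ /=; rewrite mulrA -mevalM.
(* The [E ^ m.+1] monomials with exponents below [E] outnumber the [#|I| ^ 2 * (S * C).+1 ^ m]
   coefficients of the matrices through which they act. *)
pose c := (C * m.+1).+1; pose E := (#|I| * #|I| * c ^ m).+1; pose S := (m.+1 * E)%N.
pose mn (f : {ffun 'I_m.+1 -> 'I_E}) := [multinom (f t : nat) | t < m.+1].
have mnS f : (mdeg (mn f) <= S)%N.
  rewrite mdegE; apply: leq_trans (_ : \sum_(t < m.+1) E <= S)%N.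
    by apply: leq_sum => t _; rewrite mnmE ltnW.
  by rewrite sum_nat_const card_ord.
have [Q hQ] := choice (fun f => mon S (mn f) (mnS f)).
pose mz (f : {ffun 'I_m -> 'I_(S * C).+1}) := [multinom (f t : nat) | t < m].
have [|u [f0 u0] hu] := linear_dependency (I := {ffun 'I_m.+1 -> 'I_E})
    (T := (I * I * {ffun 'I_m -> 'I_(S * C).+1})%type) (fun f t => (Q f t.1.1 t.1.2)@_(mz t.2)).
  rewrite !card_prod !card_ffun !card_ord expnS.
  (* This is the reason for the choice of [c]; since [E] exceeds [#|I| * #|I| * c ^ m], the power
     [E ^ m.+1] exceeds [#|I| * #|I| * (c * E) ^ m]. *)
  have : ((S * C).+1 <= c * E)%N by rewrite /c /S; nia.
  move=> h; apply: leq_ltn_trans (_ : #|I| * #|I| * (c * E) ^ m < _)%N.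
    by rewrite leq_mul2l; apply/orP; right; elim: (m) => // e IH; rewrite !expnS leq_mul.
  by rewrite expnMn mulnA ltn_pmul2r ?expn_gt0.
exists (\sum_f u f *: 'X_[mn f]).
  apply/negP => /eqP/(congr1 (mcoeff (mn f0))); rewrite mcoeff0 raddf_sum /=.
  rewrite (bigD1 f0) //= mcoeffZ mcoeffX eqxx mulr1 big1 ?addr0.
    by move/eqP; rewrite (negPf u0).
  move=> f ne; rewrite mcoeffZ mcoeffX; case: eqP => [e|]; last by rewrite mulr0.
  case/eqP: ne; apply/ffunP => t; apply: val_inj.
  by move/mnmP/(_ t): e; rewrite !mnmE.
move=> b Ab; have [i wi] := w0 b Ab.
have Q0 k : \sum_f u f *: Q f i k = 0.
  apply/mpolyP => a; rewrite mcoeff0 raddf_sum /=.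
  have [ha|ha] := leqP (mdeg a) (S * C)%N; last first.
    rewrite big1 // => f _; rewrite mcoeffZ; have [/(_ i k) sQ _] := hQ f.
    by rewrite (memN_msupp_eq0 (msize_mdeg_ge (leq_trans sQ ha))) mulr0.
  have la t : (a t < (S * C).+1)%N.
    by rewrite ltnS; apply: leq_trans ha; rewrite mdegE (bigD1 t) //= leq_addr.
  have := hu (i, k, [ffun t => Ordinal (la t)]); rewrite /=.
  have -> : mz [ffun t => Ordinal (la t)] = a by apply/mnmP => t; rewrite mnmE ffunE.
  by move=> e; rewrite -[RHS]e; apply: eq_bigr => f _; rewrite mcoeffZ.
(* The coordinate [w b i] is nonzero, so this factor can be cancelled from the relation. *)
have RS0 : R.@[z b] ^+ S * w b i != 0 by rewrite mulf_neq0 ?expf_neq0 ?hR.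
apply: (mulIf RS0); rewrite mul0r meval_sum big_distrl /=.
transitivity (\sum_f u f * \sum_k (Q f i k).@[z b] * w b k).
  by apply: eq_bigr => f _; have [_ <-] := hQ f; rewrite // mevalZ -mulrA [X in _ * X]mulrCA.
transitivity (\sum_k (\sum_f u f *: Q f i k).@[z b] * w b k).
  under eq_bigr do rewrite big_distrr /=.
  rewrite exchange_big; apply: eq_bigr => k _ /=; rewrite meval_sum big_distrl.
  by apply: eq_bigr => f _ /=; rewrite mevalZ mulrA.
by rewrite big1 // => k _; rewrite Q0 meval0 mul0r.
Qed.

End Dependence.

(** * Expansion of forms in monomials *)

Section MonomialSums.
Variables (K : comNzRingType) (n : nat).

Definition homog_monomial d : finType := {a : 'X_{1..n < d.+1} | mdeg a == d}.

Definition mon_of d (a : homog_monomial d) : 'X_{1..n} := val (val a).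

Lemma mdeg_mono d (a : homog_monomial d) : mdeg (mon_of a) = d.
Proof. exact/eqP/(valP a). Qed.

Lemma monoP d (a : 'X_{1..n}) : mdeg a = d -> exists c : homog_monomial d, mon_of c = a.
Proof.
move=> e; have h : (mdeg a < d.+1)%N by rewrite e.
have h' : mdeg (BMultinom h) == d by apply/eqP.
by exists (exist _ (BMultinom h) h').
Qed.

Lemma mono_inj d : injective (@mon_of d).
Proof. by move=> a b /val_inj/val_inj. Qed.

Lemma homog_expand d (p : {mpoly K[n]}) : p \is d.-homog ->
  p = \sum_(a : homog_monomial d) p@_(mon_of a) *: 'X_[mon_of a].
Proof.
move=> hp; apply/mpolyP => b; rewrite raddf_sum /=.
have [/eqP hb|hb] := boolP (mdeg b == d).
  have [c <-] := monoP hb; rewrite (bigD1 c) //= mcoeffZ mcoeffX eqxx mulr1 big1 ?addr0 //.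
  by move=> a ne; rewrite mcoeffZ mcoeffX (inj_eq (@mono_inj d)) (negPf ne) mulr0.
rewrite (dhomog_nemf_coeff hp hb) big1 // => a _; rewrite mcoeffZ mcoeffX.
by case: eqP => [e|]; rewrite ?mulr0 //; move: hb; rewrite -e mdeg_mono eqxx.
Qed.

Lemma mcoeff_mulX (p : {mpoly K[n]}) (g a : 'X_{1..n}) :
  (p * 'X_[g])@_a = if (g <= a)%MM then p@_(a - g) else 0.
Proof.
case: ifPn => ga; first by rewrite -{1}(submK ga) addmC mcoeffMX.
apply: memN_msupp_eq0; apply: contra ga; rewrite (perm_mem (msuppMX p g)).
by case/mapP => m' _ ->; apply: lem_addr.
Qed.

End MonomialSums.

(** * Families of forms without common zero *)

Section FiniteFamilies.
Variables (K : numClosedFieldType) (B : Type) (m : nat) (z : B -> 'I_m -> K).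
Variables (n : nat) (Ix : finType) (dg : Ix -> nat) (f : Ix -> B -> {mpoly K[n]}).
Hypothesis f_homog : forall i b, f i b \is (dg i).-homog.
Hypothesis dg_gt0 : forall i, (0 < dg i)%N.
Hypothesis f_coef : forall i a, polyfun z (fun b => (f i b)@_a).
Hypothesis f_empty : forall b c, (forall i, (f i b).@[c] = 0) -> forall j, c j = 0.

Definition form_ideal b e (p : {mpoly K[n]}) := exists q : Ix -> {mpoly K[n]},
  (forall i, if (dg i <= e)%N then q i \is (e - dg i)%N.-homog else q i == 0) /\
  p = \sum_i q i * f i b.

Lemma form_ideal_graded b : graded_ideal (form_ideal b).
Proof.
split.
- move=> e p [q [hq ->]]; apply: rpred_sum => i _; have := hq i.
  case: ifP => [le hqi|_ /eqP->]; last by rewrite mul0r rpred0.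
  by have := dhomogM hqi (f_homog i b); rewrite subnK.
- move=> e; exists (fun=> 0); split=> [i|]; first by rewrite eqxx rpred0 if_same.
  by rewrite big1 // => i _; rewrite mul0r.
- move=> e _ _ [q [hq ->]] [q' [hq' ->]]; exists (fun i => q i + q' i); split=> [i|].
    move: (hq i) (hq' i); case: ifP => [_ h h'|_ /eqP-> /eqP->]; last by rewrite addr0.
    by rewrite rpredD.
  by rewrite -big_split; apply: eq_bigr => i _ /=; rewrite mulrDl.
- move=> k e r _ hr [q [hq ->]]; exists (fun i => r * q i); split=> [i|].
    move: (hq i); case: ifP => [le h|_ /eqP->]; last by rewrite mulr0 rpred0 eqxx if_same.
    by have := dhomogM hr h; rewrite (leq_trans le (leq_addl _ _)) -addnBA.
  by rewrite big_distrr; apply: eq_bigr => i _ /=; rewrite mulrA.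
Qed.

Lemma form_ideal_mem b i : form_ideal b (dg i) (f i b).
Proof.
exists (fun j => (j == i)%:R); split=> [j|].
  have [->|_] := eqVneq j i; first by rewrite leqnn subnn dhomog1.
  by rewrite eqxx rpred0 if_same.
rewrite (bigD1 i) //= eqxx mul1r big1 ?addr0 // => j /negPf->.
by rewrite mul0r.
Qed.

Lemma form_ideal_full b : exists e, full (form_ideal b) e.+1.
Proof.
have hI := form_ideal_graded b; apply: contrapT => h.
have [|c [[j cj] hc]] := projective_nullstellensatz hI.
  by move=> e he; apply: h; exists e; apply: (@fullD _ _ _ 1).
by move/eqP: cj; apply; apply: f_empty => i; apply: hc (form_ideal_mem b i).
Qed.

Section Degree.
Variable e : nat.

Definition ideal_row := (Ix * 'X_{1..n < e.+1})%type.
Definition ideal_col := homog_monomial n e.+1.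

(** The Macaulay matrix in degree [e + 1]: its rows are the products of the [f i b] with monomials
    of complementary degree. Pairs of any other degree give zero rows. *)
Definition ideal_entry b (r : ideal_row) (a : ideal_col) : K :=
  if (dg r.1 + mdeg r.2 == e.+1)%N then (f r.1 b * 'X_[r.2])@_(mon_of a) else 0.

Lemma ideal_entry_polyfun r a : polyfun z (fun b => ideal_entry b r a).
Proof.
rewrite /ideal_entry; case: (_ == e.+1)%N; last by exists 0 => b; rewrite meval0.
have [P hP] := f_coef r.1 (mon_of a - r.2)%MM.
exists (if (r.2 <= mon_of a)%MM then P else 0) => b; rewrite mcoeff_mulX.
by case: ifP => _; rewrite ?meval0.
Qed.

Definition ideal_mx b : 'M[K]_(#|{: ideal_row}|, #|{: ideal_col}|) :=
  \matrix_(i, j) ideal_entry b (enum_val i) (enum_val j).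

(** The cofactors that express the monomials of degree [e + 1] through the [f i b] form a left
    inverse of the matrix. *)
Lemma ideal_mx_full b : full (form_ideal b) e.+1 -> row_full (ideal_mx b).
Proof.
move=> hf.
have hq (a : ideal_col) : exists q : Ix -> {mpoly K[n]},
    (forall i, if (dg i <= e.+1)%N then q i \is (e.+1 - dg i)%N.-homog else q i == 0) /\
    'X_[mon_of a] = \sum_i q i * f i b.
  by apply: hf; rewrite dhomogX /= mdeg_mono.
have {hq}[q hq] := choice hq.
apply/row_fullP; exists (\matrix_(j, i)
  (let r := enum_val i : ideal_row in
   if (dg r.1 + mdeg r.2 == e.+1)%N then (q (enum_val j) r.1)@_(r.2) else 0)).
apply/matrixP => j j'; rewrite !mxE.
transitivity (('X_[mon_of (enum_val j)] : {mpoly K[n]})@_(mon_of (enum_val j'))); last first.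
  by rewrite mcoeffX (inj_eq (@mono_inj _ _)) (inj_eq enum_val_inj).
set a := enum_val j; set a' := enum_val j'.
have [hqa ->] := hq a.
transitivity (\sum_(r : ideal_row) (if (dg r.1 + mdeg r.2 == e.+1)%N then (q a r.1)@_(r.2) else 0)
    * ideal_entry b r a').
  rewrite [RHS](reindex_onto enum_val enum_rank) => [|r _]; last exact: enum_rankK.
  by apply: eq_big => [i|i _]; rewrite ?enum_valK ?eqxx // !mxE.
rewrite raddf_sum /= (eq_bigr (fun r : ideal_row => (fun i (g : 'X_{1..n < e.+1}) =>
   (if (dg i + mdeg g == e.+1)%N then (q a i)@_g else 0) * ideal_entry b (i, g) a') r.1 r.2)); last by case.
rewrite -(pair_bigA _ (fun i (g : 'X_{1..n < e.+1}) =>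
   (if (dg i + mdeg g == e.+1)%N then (q a i)@_g else 0) * ideal_entry b (i, g) a')) /=.
apply: eq_bigr => i _; move: (hqa i); case: ifPn => [le hqi|nle /eqP->]; last first.
  rewrite mul0r mcoeff0 big1 // => g _; rewrite mcoeff0 if_same mul0r.
  done.
(* As [dg i] is positive, the cofactors have degree at most [e], so all their monomials occur among
   the row indices. *)
have sz : (msize (q a i) <= e.+1)%N.
  rewrite msizeE; apply/bigmax_leqP_seq => g hg _.
  by move/dhomogP: hqi => /(_ g hg) /= ->; rewrite ltn_subrL dg_gt0.
rewrite [in RHS](mpolywE sz) big_distrl raddf_sum /=; apply: eq_bigr => g _.
rewrite /ideal_entry /= -scalerAl mcoeffZ mulrC [_ * f i b]mulrC.
have [/eqP h|h] := boolP (_ == _); first by rewrite mulrC.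
rewrite (dhomog_nemf_coeff hqi) ?mul0r //=.
by apply: contra h => /eqP->; rewrite subnKC.
Qed.

Definition entry_poly r a : {mpoly K[m]} := sval (cid (ideal_entry_polyfun r a)).

Lemma entry_polyE b r a : (entry_poly r a).@[z b] = ideal_entry b r a.
Proof. by rewrite /entry_poly; case: cid. Qed.

Definition minor_mx (phi : {ffun 'I_#|{: ideal_col}| -> 'I_#|{: ideal_row}|}) :=
  \matrix_(i, j < #|{: ideal_col}|)
    entry_poly (enum_val (phi i) : ideal_row) (enum_val j : ideal_col).

Lemma minor_mxE b phi : map_mx (meval (z b)) (minor_mx phi) = rowsub phi (ideal_mx b).
Proof. by apply/matrixP => i j; rewrite !mxE entry_polyE. Qed.

Lemma minor_neq0 b : full (form_ideal b) e.+1 ->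
  exists phi, (\det (minor_mx phi)).@[z b] != 0.
Proof.
move=> /ideal_mx_full hb; exists (fullrankfun hb).
by rewrite -det_map_mx minor_mxE -unitfE -unitmxE fullrowsub_unit.
Qed.

Lemma ideal_entry_eval b (r : ideal_row) c :
  \sum_(a : ideal_col) ideal_entry b r a * ('X_[mon_of a]).@[c] =
  if (dg r.1 + mdeg r.2 == e.+1)%N then (f r.1 b).@[c] * ('X_[r.2]).@[c] else 0.
Proof.
rewrite /ideal_entry; have [/eqP h|_] := boolP (_ == _); last first.
  by rewrite big1 // => a _; rewrite mul0r.
rewrite -mevalM [in RHS](@homog_expand _ _ e.+1 (_ * _)).
  by rewrite meval_sum; apply: eq_bigr => a _; rewrite mevalZ.
have hX : 'X_[r.2] \is [in K[n], (mdeg r.2).-homog] by rewrite dhomogX.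
by have := dhomogM (f_homog r.1 b) hX; rewrite h.
Qed.

(** The vector consists of the monomials of degree at most [e] in [x b]. By Cramer's rule, where the
    minor is nonzero, a monomial of degree [e + 1] is a combination of the values [f i] at [x b]
    times monomials of degree at most [e]; so multiplication by a coordinate acts on the vector. *)
Lemma minor_finite phi (x : B -> 'I_n -> K) :
    (forall i, polyfun z (fun b => (f i b).@[x b])) ->
  finite_over z [set b | (\det (minor_mx phi)).@[z b] != 0] [set g | exists j, g = fun b => x b j].
Proof.
move=> /choice[g hg]; set R := \det _.
exists 'X_{1..n < e.+1}, (fun b (a : 'X_{1..n < e.+1}) => ('X_[a]).@[x b]); split=> [b _|_ [j ->]].
  by exists (@bm0 n e); rewrite mpolyX0 meval1 oner_neq0.
pose row (k : 'I_#|{: ideal_col}|) : ideal_row := enum_val (phi k).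
pose adj (a : ideal_col) k := \adj (minor_mx phi) (enum_rank a) k.
pose M (c : 'X_{1..n < e.+1}) (h : 'X_{1..n < e.+1}) : {mpoly K[m]} :=
  \sum_(a : ideal_col | mon_of a == (U_(j) + c)%MM)
    \sum_(k | (row k).2 == h) (if (dg (row k).1 + mdeg h == e.+1)%N then adj a k * g (row k).1 else 0)
  + (if (U_(j) + c)%MM == h then R else 0).
exists R, M => b /= R0; split=> // c.
rewrite -mevalXU -mevalM -mpolyXD.
(* In degree at most [e] the product is another entry of the vector, and the matrix entry is [R]; in
   degree [e + 1] the adjugate brings it back. *)
have [h|h] := leqP (mdeg (U_(j) + c)) e.
  rewrite (bigD1 (BMultinom (h : (mdeg (U_(j) + c)%MM < e.+1)%N))) //= big1 ?addr0.
    rewrite /M big_pred0 ?add0r ?eqxx // => a; apply/negP => /eqP ea.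
    by move: h; rewrite -ea mdeg_mono ltnn.
  move=> d ne; rewrite /M big_pred0 ?add0r.
    case: eqP => [ed|_]; last by rewrite meval0 mul0r.
    by case/eqP: ne; apply: val_inj; rewrite /= ed.
  by move=> a; apply/negP => /eqP ea; have := h; rewrite -ea mdeg_mono ltnn.
have [a ea] : exists a : ideal_col, mon_of a = (U_(j) + c)%MM.
  apply: monoP; apply/eqP; rewrite eqn_leq h andbT.
  by rewrite mdegD mdeg1 add1n; exact: bmdeg.
have MS d : M c d = \sum_(k | (row k).2 == d)
    (if (dg (row k).1 + mdeg d == e.+1)%N then adj a k * g (row k).1 else 0).
  rewrite /M (big_pred1 a) => [|a']; last by rewrite -ea (inj_eq (@mono_inj _ _)).
  case: eqP => [ed|_]; last by rewrite addr0.
  by move: h; rewrite ed ltnNge -ltnS bmdeg.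
under eq_bigr do rewrite MS meval_sum big_distrl /=.
rewrite (exchange_big_dep predT) //=.
transitivity (\sum_k (adj a k).@[z b] * \sum_(a' : ideal_col) ideal_entry b (row k) a' * ('X_[mon_of a']).@[x b]).
  under [RHS]eq_bigr do rewrite big_distrr /=.
  rewrite exchange_big /= (bigD1 a) //= [X in _ + X]big1 ?addr0.
    rewrite -ea; under eq_bigr do rewrite mulrA.
    rewrite -big_distrl; congr (_ * _) => /=.
    have /matrixP/(_ (enum_rank a) (enum_rank a)) := mul_adj_mx (minor_mx phi).
    rewrite !mxE eqxx mulr1n => /(congr1 (meval (z b))); rewrite meval_sum => <-.
    by apply: eq_bigr => k _; rewrite mevalM; congr (_ * _); rewrite mxE enum_rankK entry_polyE.
  move=> a' ne; under eq_bigr do rewrite mulrA.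
  rewrite -big_distrl /= [X in X * _](_ : _ = 0) ?mul0r //.
  have /matrixP/(_ (enum_rank a) (enum_rank a')) := mul_adj_mx (minor_mx phi).
  rewrite !mxE (inj_eq enum_rank_inj) eq_sym (negPf ne) mulr0n => /(congr1 (meval (z b))).
  rewrite meval_sum meval0 => E0; rewrite -[RHS]E0.
  by apply: eq_bigr => k _; rewrite mevalM; congr (_ * _); rewrite mxE enum_rankK entry_polyE.
apply: eq_bigr => k _; rewrite ideal_entry_eval (big_pred1 (row k).2) //=.
by case: ifP => _; rewrite ?mevalM ?hg ?mulrA // meval0 mulr0 mul0r.
Qed.

End Degree.

(** For each [b] the Nullstellensatz gives a nonzero minor in some degree; finitely many of these
    minors suffice for all [b]. *)
Lemma points_finite (T : Type) (x : T -> B -> 'I_n -> K) :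
    (forall t i, polyfun z (fun b => (f i b).@[x t b])) ->
  exists s : seq {mpoly K[m]}, (forall b, exists2 p, p \in s & p.@[z b] != 0) /\
    forall p, p \in s -> forall t,
      finite_over z [set b | p.@[z b] != 0] [set g | exists j, g = fun b => x t b j].
Proof.
move=> hx; have [s [sS hs]] := finite_zeros
  [set p : {mpoly K[m]} | exists e (phi : {ffun 'I_#|{: ideal_col e}| -> 'I_#|{: ideal_row e}|}),
     p = \det (minor_mx phi)].
exists s; split=> [b|p /sS[e [phi ->]] t]; last exact: minor_finite.
have [e /minor_neq0[phi /eqP nz]] := form_ideal_full b.
apply: contrapT => h; apply: nz; apply: hs; last by exists e, phi.
move=> p ps; apply: contrapT => /eqP pz; apply: h; by exists p.
Qed.

End FiniteFamilies.

Lemma polyfun_cst (K : fieldType) (B : Type) m (z : B -> 'I_m -> K) c : polyfun z (fun=> c).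
Proof. by exists c%:MP => b; rewrite mevalC. Qed.

(** * Algebraic relations and common zeros of forms *)

Section Dependencies.
Variables (K : numClosedFieldType).

(** Each minor of the finite cover gives a relation on the locus where it is nonzero, and the
    product of these relations holds everywhere. The last hypothesis expresses that the [y s] are
    algebraic over [z] and the coordinates of the points [x t]; the equation on [M] lets [M] be a
    cardinal. *)
Lemma points_dependence (B : Type) m (z : B -> 'I_m -> K) n (Ix : finType) (dg : Ix -> nat)
    (f : Ix -> B -> {mpoly K[n]}) (T : finType) (x : T -> B -> 'I_n -> K)
    M (y : 'I_M -> B -> K) : M = m.+1 ->
    (forall i b, f i b \is (dg i).-homog) -> (forall i, 0 < dg i)%N ->
    (forall i a, polyfun z (fun b => (f i b)@_a)) ->
    (forall b c, (forall i, (f i b).@[c] = 0) -> forall j, c j = 0) ->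
    (forall t i, polyfun z (fun b => (f i b).@[x t b])) ->
    (forall A (I : finType) (w : B -> I -> K),
      (forall t j, eigen_over z A w (fun b => x t b j)) -> forall s, eigen_over z A w (y s)) ->
  exists2 Phi : {mpoly K[M]}, Phi != 0 & forall b, Phi.@[fun s => y s b] = 0.
Proof.
move=> eM; move: y; rewrite {M}eM => y f_homog dg_gt0 f_coef f_empty hx hy.
have [s [cov fin]] := points_finite f_homog dg_gt0 f_coef f_empty hx.
have {}fin p : p \in s -> exists2 Phi : {mpoly K[m.+1]}, Phi != 0 &
    forall b, p.@[z b] != 0 -> Phi.@[fun s => y s b] = 0.
  move=> ps; have [I [w [w0 hw]]] := finite_over_bigcup (enum T) (fin p ps).
  apply: (@algebraic_dependence _ _ _ z [set b | p.@[z b] != 0] (range y)).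
    exists I, w; split=> // g [t _ <-]; apply: hy => u j; apply: hw => /=.
    elim: (enum T) (mem_enum T u) => [|u' r IH] //.
    rewrite inE => /orP[/eqP<-|/IH h]; first by left; exists j.
    by right.
  by move=> t; exists t.
have {cov}cov b : exists2 p, p \in s & p.@[z b] != 0 by apply: cov.
suff [Phi P0 hP] : exists2 Phi : {mpoly K[m.+1]}, Phi != 0 &
    forall p b, p \in s -> p.@[z b] != 0 -> Phi.@[fun s => y s b] = 0.
  by exists Phi => // b; have [p ps pb] := cov b; apply: hP ps pb.
elim: s fin {cov} => [|p s IH] fin; first by exists 1; rewrite ?oner_neq0.
have [|P1 P10 h1] := IH; first by move=> q qs; apply: fin; rewrite inE qs orbT.
have [P2 P20 h2] := fin p (mem_head _ _).
exists (P1 * P2); first by rewrite mulf_neq0.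
move=> q b; rewrite inE mevalM => /orP[/eqP->/h2->|qs qb]; first by rewrite mulr0.
by rewrite (h1 q b) ?mul0r.
Qed.

(** On the zero locus of [f] the values of [l] serve as parameters: as [f] and [l] have only the
    trivial common zero, the coordinates are finite over these [m] functions. *)
Lemma forms_dependence n (Ix : finType) (dg : Ix -> nat) (f : Ix -> {mpoly K[n]})
    m (l : 'I_m -> {mpoly K[n]}) (e : 'I_m -> nat) (g : 'I_m.+1 -> {mpoly K[n]}) :
    (forall i, f i \is (dg i).-homog) -> (forall i, 0 < dg i)%N ->
    (forall i, l i \is (e i).-homog) -> (forall i, 0 < e i)%N ->
    (forall c, (forall i, (f i).@[c] = 0) -> (forall i, (l i).@[c] = 0) -> forall j, c j = 0) ->
  exists2 Phi : {mpoly K[m.+1]}, Phi != 0 &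
    forall x, (forall i, (f i).@[x] = 0) -> Phi.@[fun t => (g t).@[x]] = 0.
Proof.
move=> hf dg0 hl e0 emp.
pose B := {x : 'I_n -> K | forall i, (f i).@[x] = 0}.
pose z (b : B) i := (l i).@[sval b].
have [||||||Phi P0 hP] := @points_dependence B m z n (Ix + 'I_m)%type
  (fun i => match i with inl i => dg i | inr i => e i end)
  (fun i _ => match i with inl i => f i | inr i => l i end)
  unit (fun _ b => sval b) m.+1 (fun t b => (g t).@[sval b]) erefl.
- by case.
- by case.
- by move=> i a; apply: polyfun_cst.
- by move=> _ c hc; apply: emp => i; [apply: (hc (inl i)) | apply: (hc (inr i))].
- case=> -[] i; last by exists 'X_i => b; rewrite mevalXU.
  by exists 0 => -[b hb] /=; rewrite meval0 hb.
- by move=> A I w hx t; apply: eigen_meval => j; apply: (hx tt).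
by exists Phi => // x hx; apply: (hP (exist _ x hx)).
Qed.

(** Otherwise the values of the [f i] are parameters for the whole space, and [#|Ix| + 1] of the
    coordinates would be algebraically dependent. *)
Lemma forms_common_zero n (Ix : finType) (dg : Ix -> nat) (f : Ix -> {mpoly K[n]}) :
    (forall i, f i \is (dg i).-homog) -> (forall i, 0 < dg i)%N -> (#|Ix| < n)%N ->
  exists c, (exists j, c j != 0) /\ forall i, (f i).@[c] = 0.
Proof.
move=> hf dg0 lt; apply: contrapT => h.
have [|||Phi P0 hP] := @forms_dependence n void (fun _ => 0%N) (fun _ => 0) #|Ix|
  (fun i => f (enum_val i)) (fun i => dg (enum_val i)) (fun i => 'X_(widen_ord lt i)) _ _ (fun i => hf _) (fun i => dg0 _).
- by case.
- by case.
- move=> c _ hc j; apply: contrapT => cj; apply: h; exists c; split; first by exists j; apply/eqP.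
  by move=> i; rewrite -(enum_rankK i) hc.
case/eqP: P0; apply: meval_eq0 => v.
(* The vector [v] is extended by zeros to [n] coordinates. *)
rewrite -(hP (fun i => if insub (val i) is Some j then v j else 0)) ; last by case.
apply: meval_eq => i; rewrite mevalXU /=; case: insubP => [j _ ej|]; last by rewrite ltn_ord.
by congr v; apply: val_inj.
Qed.

End Dependencies.

(** * Closed sets and chains *)

Section ClosedSets.
Local Open Scope classical_set_scope.
Variables (K : numClosedFieldType) (N : nat).
Implicit Types (Z A c : set 'rV[K]_N) (x : 'rV[K]_N).

Lemma meval_rowZ d (p : {mpoly K[N]}) t x : p \is d.-homog -> p.@[(t *: x) 0] = t ^+ d * p.@[x 0].
Proof.
by move=> hp; rewrite -(meval_homog _ _ hp); apply: meval_eq => i; rewrite mxE.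
Qed.

Lemma zero_locus_closed (S : set {mpoly K[N]}) :
  (forall f, S f -> exists e, f \is e.-homog) -> zariski_closed (zero_locus S).
Proof. by move=> h; exists S. Qed.

Lemma form_locus_closed d (f : {mpoly K[N]}) : f \is d.-homog -> zariski_closed (zero_locus [set f]).
Proof. by move=> hf; apply: zero_locus_closed => _ ->; exists d. Qed.

Lemma zariski_closedI Z A : zariski_closed Z -> zariski_closed A -> zariski_closed (Z `&` A).
Proof.
move=> [S [hS ->]] [T [hT ->]]; exists (S `|` T); split=> [f [/hS|/hT]//|].
apply/seteqP; split=> x /=.
  by case=> -[x0 h1] [_ h2]; split=> // f [/h1|/h2].
by case=> x0 h; split; split=> // f hf; apply: h; [left | right].
Qed.

Lemma closed_neq0 Z x : zariski_closed Z -> Z x -> x != 0.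
Proof. by case=> S [_ ->] []. Qed.

Lemma closed_scale Z x t : zariski_closed Z -> t != 0 -> Z x -> Z (t *: x).
Proof.
case=> S [hS ->] t0 [x0 hx]; split; first by rewrite scaler_eq0 negb_or t0.
by move=> f Sf; have [e he] := hS f Sf; rewrite (meval_rowZ _ _ he) hx ?mulr0.
Qed.

Lemma closed_separation Z x : zariski_closed Z -> x != 0 -> ~ Z x ->
  exists f e, [/\ f \is e.-homog, forall y, Z y -> f.@[y 0] = 0 & f.@[x 0] != 0].
Proof.
case=> S [hS ->] x0 hx; apply: contrapT => h; apply: hx; split=> // f Sf.
have [e he] := hS f Sf; apply: contrapT => /eqP fx; apply: h; exists f, e.
by split=> // y [_]; apply.
Qed.

(** Noetherian induction: a counterexample would start an infinite strictly decreasing sequence of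
    closed sets. *)
Lemma closed_ind (P : set 'rV[K]_N -> Prop) :
    (forall Z, zariski_closed Z -> (forall A, zariski_closed A -> A `<` Z -> P A) -> P Z) ->
  forall Z, zariski_closed Z -> P Z.
Proof.
move=> step Z0 cZ0; apply: contrapT => nP.
pose T := {Z : set 'rV[K]_N | zariski_closed Z /\ ~ P Z}.
have next (t : T) : exists t' : T, sval t' `<` sval t.
  case: t => Z [cZ nPZ] /=; apply: contrapT => h; apply: nPZ; apply: step => // A cA AZ.
  by apply: contrapT => nPA; apply: h; exists (exist _ A (conj cA nPA)).
have [f hf] := choice next.
pose t i := iter i f (exist _ Z0 (conj cZ0 nP) : T).
apply: (@no_decreasing_zeros K N (fun i => [set v | exists2 x, sval (t i) x & v = x 0])).
  by move=> i v [x hx ->]; exists x => //; have [h _] := hf (t i); apply: h.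
move=> i; have [_ ns] := hf (t i).
have [x [hx nx]] : exists x, sval (t i) x /\ ~ sval (t i.+1) x.
  by apply: contrapT => h; apply: ns => x hx; apply: contrapT => nx; apply: h; exists x.
have [g [e [_ hg gx]]] := closed_separation (proj1 (svalP (t i.+1))) (closed_neq0 (proj1 (svalP (t i))) hx) nx.
exists g; split; first by move=> v [y hy ->]; apply: hg.
by move=> h; move/eqP: gx; apply; apply: h; exists x.
Qed.

(* The points meet every irreducible component of [Z]. *)
Lemma component_points Z : zariski_closed Z ->
  exists zs : seq 'rV[K]_N, (forall z, z \in zs -> Z z) /\
    forall l : {mpoly K[N]}, (forall z, z \in zs -> l.@[z 0] != 0) ->
    forall c, zariski_irreducible c -> c `<=` Z -> (forall x, c x -> l.@[x 0] = 0) ->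
  exists A, [/\ zariski_closed A, zariski_irreducible A, A `<=` Z & c `<` A].
Proof.
elim/closed_ind => {}Z cZ IH.
have [[z Zz]|Z0] := pselect (Z !=set0); last first.
  exists [::]; split=> // l _ c [[x cx] _] cZ'; case: Z0; exists x; exact: cZ'.
have [irr|nirr] := pselect (zariski_irreducible Z).
  exists [:: z]; split=> [y|l hl c hc cZ' lc]; first by rewrite inE => /eqP->.
  exists Z; split=> //; split=> // Zc; have := hl z (mem_head _ _).
  by rewrite lc ?eqxx //; apply: Zc.
(* A reducible [Z] is covered by two smaller closed sets, and an irreducible [c] lies in one of
   them; the points chosen for both are joined. *)
have [A [B [cA cB ZAB [nA nB]]]] : exists A B, [/\ zariski_closed A, zariski_closed B,
    Z `<=` A `|` B & ~ Z `<=` A /\ ~ Z `<=` B].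
  apply: contrapT => h; apply: nirr; split=> [|A B cA cB ZAB]; first by exists z.
  have [?|nA] := pselect (Z `<=` A); first by left.
  right; apply: contrapT => nB; apply: h; by exists A, B.
have strict D : ~ Z `<=` D -> Z `&` D `<` Z.
  by move=> nD; split=> [x []//|h]; apply: nD => x /h[].
have [za [hza ha]] := IH _ (zariski_closedI cZ cA) (strict _ nA).
have [zb [hzb hb]] := IH _ (zariski_closedI cZ cB) (strict _ nB).
exists (za ++ zb); split=> [y|l hl c hc cZ' lc].
  by rewrite mem_cat => /orP[/hza|/hzb] [].
have [cA'|cB'] := hc.2 A B cA cB (subset_trans cZ' ZAB).
- have [y hy||D [h1 h2 h3 h4]] := ha l _ c hc _ lc; first by apply: hl; rewrite mem_cat hy.
    by move=> x cx; split; [apply: cZ' | apply: cA'].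
  by exists D; split=> // x /h3[].
- have [y hy||D [h1 h2 h3 h4]] := hb l _ c hc _ lc; first by apply: hl; rewrite mem_cat hy orbT.
    by move=> x cx; split; [apply: cZ' | apply: cB'].
  by exists D; split=> // x /h3[].
Qed.

(** Among the forms with coefficients [1, t, t ^ 2, ...], each [z] excludes only finitely many
    values of [t]. *)
Lemma avoiding_linear_form (zs : seq 'rV[K]_N) : (forall z, z \in zs -> z != 0) ->
  exists2 l : {mpoly K[N]}, l \is 1.-homog & forall z, z \in zs -> l.@[z 0] != 0.
Proof.
move=> hz; pose P (z : 'rV[K]_N) : {poly K} := \poly_(i < N) (if @insub _ _ 'I_N i is Some j then z 0 j else 0).
have PE (z : 'rV[K]_N) (j : 'I_N) : (P z)`_j = z 0 j.
  by rewrite coef_poly ltn_ord; case: insubP => [k _ /val_inj->|]; rewrite ?ltn_ord.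
have P0 : \prod_(z <- zs) P z != 0.
  rewrite prodf_seq_neq0; apply/allP => z /hz; apply: contra => /eqP e.
  by apply/eqP/rowP => j; rewrite -PE e coef0 mxE.
have [t ht] : exists t, (\prod_(z <- zs) P z).[t] != 0.
  apply: contrapT => h; move/eqP: P0; apply; apply: poly_ext => t; rewrite horner0.
  by apply: contrapT => /eqP ht; apply: h; exists t.
exists (\sum_(j < N) t ^+ j *: 'X_j).
  by apply: rpred_sum => j _; rewrite rpredZ ?var_homog.
move=> z zs_z; move: ht; rewrite horner_prod prodf_seq_neq0 => /allP/(_ z zs_z) /=.
congr (_ != 0); rewrite horner_poly meval_sum; apply: eq_bigr => j _.
by rewrite mevalZ mevalXU mulrC; case: insubP => [k _ /val_inj->|]; rewrite ?ltn_ord.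
Qed.

Lemma point_closed x : x != 0 -> zariski_closed [set t *: x | t in [set t | t != 0]].
Proof.
move=> x0; pose S := [set f : {mpoly K[N]} | exists i j, f = x 0 i *: 'X_j - x 0 j *: 'X_i].
exists S; split=> [_ [i [j ->]]|].
  by exists 1%N; rewrite rpredB ?rpredZ ?var_homog.
apply/seteqP; split=> [_ [t t0 <-]|y [y0 hy]].
  split=> [|_ [i [j ->]]]; first by rewrite scaler_eq0 negb_or x0 andbT.
  by rewrite mevalB !mevalZ !mevalXU !mxE; ring.
have /rV0Pn[i xi] := x0.
have e j : y 0 j = y 0 i / x 0 i * x 0 j.
  have := hy _ (ex_intro _ i (ex_intro _ j erefl)).
  rewrite mevalB !mevalZ !mevalXU => /subr0_eq e; apply: (mulfI xi); rewrite e.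
  by field.
exists (y 0 i / x 0 i); last by apply/rowP => j; rewrite mxE -e.
apply/negP => /eqP z; move/eqP: y0; apply; apply/rowP => j; by rewrite e z mul0r mxE.
Qed.

Lemma point_irreducible x : zariski_irreducible [set t *: x | t in [set t | t != 0]].
Proof.
split=> [|A B cA cB h]; first by exists x, 1; rewrite ?scale1r //=; exact: oner_neq0.
have [|Ax|Bx] := h x; first by exists 1; rewrite ?scale1r //=; exact: oner_neq0.
  by left => _ [t t0 <-]; apply: closed_scale.
by right => _ [t t0 <-]; apply: closed_scale.
Qed.

(** Cut [Z] by a linear form that vanishes on none of its components. A chain in the section has its
    top in the zero locus of this form, so it can be prolonged by a larger irreducible set. *)
Lemma irreducible_chain_exists m Z : zariski_closed Z ->
    (forall l : 'I_m -> {mpoly K[N]}, (forall i, l i \is 1.-homog) ->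
      exists2 x, Z x & forall i, (l i).@[x 0] = 0) ->
  has_irreducible_chain Z m.
Proof.
elim: m Z => [|m IH] Z cZ hZ.
  have [|x Zx _] := hZ (fun=> 0); first by case.
  exists (fun=> [set t *: x | t in [set t | t != 0]]); split=> // i _; split.
  - by apply: point_closed; apply: closed_neq0 Zx.
  - exact: point_irreducible.
  - by move=> _ [t t0 <-]; apply: closed_scale.
have [zs [hzs comp]] := component_points cZ.
have [l hl lz] := avoiding_linear_form (fun z h => closed_neq0 cZ (hzs z h)).
have [||c [hc lt_c]] := IH (Z `&` zero_locus [set l]).
- by apply: zariski_closedI => //; apply: form_locus_closed hl.
(* The form [l] is appended to [l'] at the last index. *)
- move=> l' hl'; have [|x Zx hx] := hZ (fun i => if insub (val i) is Some j then l' j else l).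
    by move=> i; case: insubP.
  exists x.
    split=> //; split=> [|_ ->]; first exact: closed_neq0 Zx.
    by have := hx ord_max; rewrite insubF ?ltnn.
  move=> i; have := hx (widen_ord (leqnSn m) i); case: insubP => [j _ /val_inj->//|].
  by rewrite /= ltn_ord.
have [c1 c2 c3] := hc m (leqnn m).
have [||A [A1 A2 A3 A4]] := comp l lz (c m) c2.
- by move=> x /c3[].
- by move=> x /c3[_ [_]]; apply.
exists (fun i => if (i <= m)%N then c i else A); split=> i /=.
  case: (leqP i m) => h _; last by split.
  by have [h1 h2 h3] := hc i h; split=> // x /h3[].
rewrite ltnS => h; rewrite h; case: (ltnP i m) => h'; first exact: lt_c.
by have -> : i = m by apply/eqP; rewrite eqn_leq h.
Qed.

End ClosedSets.

(** * Upper bound for the length of chains *)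

Section ChainBound.
Local Open Scope classical_set_scope.
Variables (K : numClosedFieldType) (N : nat).
Implicit Types (Z A : set 'rV[K]_N) (x : 'rV[K]_N).

Lemma mpoly_split M (k : 'I_M) (p : {mpoly K[M]}) : exists p0 p1,
  [/\ p = p0 + 'X_k * p1, forall a, p0@_a = if a k == 0%N then p@_a else 0 &
      forall a, p1@_a = p@_(a + U_(k))].
Proof.
elim/mpolyind: p => [|c m p _ _ [p0 [p1 [ep h0 h1]]]].
  by exists 0, 0; rewrite mulr0 addr0; split=> // a; rewrite !mcoeff0 ?if_same.
have [m0|m0] := eqVneq (m k) 0%N.
  exists (c *: 'X_[m] + p0), p1; split=> [|a|a]; first by rewrite ep addrA.
    rewrite !mcoeffD h0 !mcoeffZ !mcoeffX; case: (m =P a) => [<-|_]; first by rewrite m0.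
    by rewrite !mulr0 !add0r.
  rewrite h1 mcoeffD mcoeffZ mcoeffX; case: eqP => [e|]; last by rewrite mulr0 add0r.
  by move: m0; rewrite e mnmDE mnm1E eqxx addn1.
have Um : (U_(k) <= m)%MM by rewrite lep1mP.
exists p0, (c *: 'X_[m - U_(k)] + p1); split=> [|a|a].
- rewrite mulrDr -scalerAr -mpolyXD addmC submK // ep addrCA; congr (_ + _).
- rewrite h0 mcoeffD mcoeffZ mcoeffX; case: (m =P a) => [<-|_]; last by rewrite mulr0 add0r.
  by rewrite (negPf m0).
rewrite !mcoeffD h1 !mcoeffZ !mcoeffX; congr (_ * _%:R + _).
by rewrite -(eqm_add2r U_(k)) submK.
Qed.

Lemma irreducible_mul Z d e (f g : {mpoly K[N]}) : zariski_closed Z -> zariski_irreducible Z ->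
    f \is d.-homog -> g \is e.-homog -> (forall x, Z x -> f.@[x 0] * g.@[x 0] = 0) ->
  (forall x, Z x -> f.@[x 0] = 0) \/ (forall x, Z x -> g.@[x 0] = 0).
Proof.
move=> cZ [_ irr] hf hg h.
have [|h'|h'] := irr _ _ (form_locus_closed hf) (form_locus_closed hg).
- move=> x Zx; have x0 := closed_neq0 cZ Zx.
  by move/eqP: (h x Zx); rewrite mulf_eq0 => /orP[] /eqP e0; [left | right]; split=> // _ ->.
- by left => x /h'[_]; apply.
- by right => x /h'[_]; apply.
Qed.

Lemma homog0_const M (p : {mpoly K[M]}) : p \is 0.-homog -> p = (p@_0%MM)%:MP.
Proof.
move=> hp; apply/mpolyP => a; rewrite mcoeffC; have [->|a0] := eqVneq a 0%MM.
  by rewrite mulr1.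
by rewrite mulr0 (dhomog_nemf_coeff hp) //= mdeg_eq0.
Qed.

(* [k] bounds the indices of the variables occurring in [Phi]: modulo [X_k], restrict the relation
   to [c (k - 1)], where [g k] vanishes; then divide it by [g k] on the irreducible set [c k]. *)
Lemma chain_independence (c : nat -> set 'rV[K]_N) M D (g : 'I_M -> {mpoly K[N]}) :
    (forall i, (i < M)%N -> zariski_closed (c i) /\ zariski_irreducible (c i)) ->
    (forall i, (i.+1 < M)%N -> c i `<=` c i.+1) ->
    (forall i, g i \is D.-homog) ->
    (forall i : 'I_M, ~ forall x, c i x -> (g i).@[x 0] = 0) ->
    (forall (i : 'I_M) j, i = j.+1 :> nat -> forall x, c j x -> (g i).@[x 0] = 0) ->
  forall k d (Phi : {mpoly K[M]}), (k <= M)%N -> (0 < k)%N || (0 < d)%N -> Phi \is d.-homog ->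
    (forall a (i : 'I_M), a \in msupp Phi -> (k <= i)%N -> a i = 0%N) ->
    (forall j, k = j.+1 -> forall x, c j x -> Phi.@[fun i => (g i).@[x 0]] = 0) -> Phi = 0.
Proof.
move=> hc cS hg gn gz; elim=> [|k IHk] d.
  move=> Phi _ /= d0 /dhomogP hPhi supp _; apply/eqP; rewrite -msize_poly_eq0 mmeasure_msupp0.
  case: (msupp Phi) hPhi supp => // a s hPhi supp; have := hPhi a (mem_head _ _).
  by rewrite /= mdegE big1 => [e|i _]; [move: d0; rewrite -e | apply: supp; rewrite ?mem_head].
elim: d => [|d IHd] Phi kM _ hPhi supp vanish.
  have [[x cx] _] := (hc k kM).2; have := vanish k erefl x cx.
  by rewrite (homog0_const hPhi) mevalC => ->; rewrite mpolyC0.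
pose ko : 'I_M := Ordinal kM.
have [P0 [P1 [eP h0 h1]]] := mpoly_split ko Phi.
have ev x : Phi.@[fun i => (g i).@[x 0]] =
    P0.@[fun i => (g i).@[x 0]] + (g ko).@[x 0] * P1.@[fun i => (g i).@[x 0]].
  by rewrite eP mevalD mevalM mevalXU.
have hP0 : P0 \is d.+1.-homog.
  apply/dhomogP => a; rewrite mcoeff_msupp h0; case: ifP => _; last by rewrite eqxx.
  by rewrite -mcoeff_msupp; apply/dhomogP.
have hP1 : P1 \is d.-homog.
  apply/dhomogP => a; rewrite mcoeff_msupp h1 -mcoeff_msupp => ha.
  by have /dhomogP/(_ _ ha) := hPhi; rewrite /= mdegD mdeg1 addn1 => -[].
have P00 : P0 = 0.
  apply: (IHk d.+1); rewrite ?orbT //; first exact: ltnW.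
    move=> a i; rewrite mcoeff_msupp h0; case: (eqVneq (a ko) 0%N) => [e|_]; last by rewrite eqxx.
    rewrite -mcoeff_msupp leq_eqVlt => ha /orP[/eqP ki|]; last exact: supp.
    by rewrite -e; congr (a _); apply: val_inj.
  move=> j ej x cjx; have ckx : c k x by rewrite ej; apply: cS => //; rewrite -ej.
  by have := vanish k erefl x ckx; rewrite ev (gz ko j) // mul0r addr0.
have P10 : P1 = 0.
  have gP1 : P1 \mPo [tuple g i | i < M] \is (D * d)%N.-homog.
    by apply: comp_homog => // i; rewrite tnth_mktuple.
  have evP1 x : (P1 \mPo [tuple g i | i < M]).@[x 0] = P1.@[fun i => (g i).@[x 0]].
    by rewrite comp_mpoly_meval; apply: meval_eq => i; rewrite tnth_mktuple.
  have [ck ik] := hc k kM.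
  have [|/(gn ko)//|hv] := irreducible_mul ck ik (hg ko) gP1.
    by move=> x cx; have := vanish k erefl x cx; rewrite ev P00 meval0 add0r evP1.
  apply: IHd => //.
    move=> a i; rewrite mcoeff_msupp h1 -mcoeff_msupp => /supp h /h.
    by rewrite mnmDE => /eqP; rewrite addn_eq0 => /andP[/eqP].
  by move=> _ [<-] x cx; rewrite -evP1 hv.
by rewrite eP P00 P10 mulr0 addr0.
Qed.

(** A chain with [m + 1] members gives [m + 1] forms, each vanishing on the previous member but not
    on its own. They are dependent on the zero locus of [f], which [chain_independence] excludes. *)
Lemma irreducible_chain_bound (Ix : finType) (dg : Ix -> nat) (f : Ix -> {mpoly K[N]})
    m (l : 'I_m -> {mpoly K[N]}) Z r :
    (forall i, f i \is (dg i).-homog) -> (forall i, 0 < dg i)%N ->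
    (forall i, l i \is 1.-homog) ->
    (forall c, (forall i, (f i).@[c] = 0) -> (forall i, (l i).@[c] = 0) -> forall j, c j = 0) ->
    (forall x, Z x -> forall i, (f i).@[x 0] = 0) ->
  has_irreducible_chain Z r -> (r < m)%N.
Proof.
move=> hf dg0 hl emp Zf [c [hc lt_c]]; rewrite ltnNge; apply/negP => mr.
have cl i : (i <= m)%N -> [/\ zariski_closed (c i), zariski_irreducible (c i) & c i `<=` Z].
  by move=> im; apply: hc; apply: leq_trans mr.
have hsep (i : 'I_m.+1) : exists q : {mpoly K[N]} * nat * 'rV[K]_N,
    [/\ q.1.1 \is q.1.2.-homog, (0 < q.1.2)%N, c i q.2, q.1.1.@[q.2 0] != 0 &
      forall j, i = j.+1 :> nat -> forall y, c j y -> q.1.1.@[y 0] = 0].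
  have im : (i <= m)%N by rewrite -ltnS.
  case ei : (i : nat) (cl i im) => [|j] [ci irr _].
    have [[x cx] _] := irr; have /rV0Pn[k xk] := closed_neq0 ci cx.
    by exists ('X_k, 1%N, x); split=> //=; rewrite ?var_homog ?mevalXU.
  have jm : (j < r)%N by rewrite -ei; apply: leq_trans mr.
  have [_ nsub] := lt_c j jm.
  have [x [cx ncx]] : exists x, c j.+1 x /\ ~ c j x.
    by apply: contrapT => h; apply: nsub => x cx; apply: contrapT => ncx; apply: h; exists x.
  have [cj [[y cy] _] _] := cl j (ltnW (leq_trans (eq_leq (esym ei)) im)).
  have [q [e [hq q0 qx]]] := closed_separation cj (closed_neq0 ci cx) ncx.
  exists (q, e, x); split=> //=; last by move=> _ [<-].
  case: e hq => // /homog0_const eq; move: qx (q0 y cy); rewrite eq !mevalC => /eqP.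
  by [].
have [q hq] := choice hsep.
(* Suitable powers bring all the separating forms to a common degree [D]. *)
pose D := (\prod_i (q i).1.2)%N; pose g i := (q i).1.1 ^+ (D %/ (q i).1.2).
have dD i : ((q i).1.2 %| D)%N by rewrite /D (bigD1 i) //= dvdn_mulr.
have Dgt i : (0 < D %/ (q i).1.2)%N.
  have [_ h _ _ _] := hq i; rewrite divn_gt0 // dvdn_leq //.
  by rewrite prodn_gt0 // => j; have [] := hq j.
have hg i : g i \is D.-homog.
  by have [h _ _ _ _] := hq i; have := dhomogMn (D %/ (q i).1.2) h; rewrite mulnC divnK.
have [Phi P0 hPhi] := forms_dependence g hf dg0 hl (fun _ => erefl : (0 < 1)%N) emp.
have [d pd] : exists d, pihomog mdeg d Phi != 0.
  apply: contrapT => h; move/eqP: P0; apply.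
  rewrite (pihomog_partitionE (leqnn (msize Phi))) big1 // => d _.
  by apply/eqP; apply: contrapT => /negP hd; apply: h; exists d.
move/eqP: pd; apply; apply: (@chain_independence c m.+1 D g _ _ hg _ _ m.+1 d) => //.
- by move=> i; rewrite ltnS => /cl[].
- by move=> i; rewrite ltnS => im; have [] := lt_c i (leq_trans im mr).
- move=> i h; have [_ _ cx /eqP nz _] := hq i; move: (h _ cx); rewrite mevalXn => /eqP.
  by rewrite expf_eq0 => /andP[_ /eqP].
- move=> i j e x cx; have [_ _ _ _ h] := hq i; rewrite mevalXn (h j e x cx).
  by rewrite expr0n gtn_eqF.
- exact: pihomogP.
- by move=> a i _; rewrite leqNgt ltn_ord.
move=> j [<-] x cx; apply: pihomog_eval0 => s s0.
have [cm _ mZ] := cl m (leqnn m).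
have D0 : (0 < D)%N by rewrite prodn_gt0 // => k; have [] := hq k.
(* Scaling [x] by a [D]-th root of [s] multiplies every [g i] by [s], so the relation passes to its
   homogeneous parts. *)
have sE := rootCK D0 s; set t := D.-root s in sE.
have t0 : t != 0 by apply: contraNneq s0 => e; rewrite -sE e expr0n gtn_eqF.
have := hPhi ((t *: x) 0) (Zf _ (mZ _ (closed_scale cm t0 cx))).
by move=> <-; apply: meval_eq => k; rewrite (meval_rowZ _ _ (hg k)) sE.
Qed.

End ChainBound.

(** * Taylor expansion at a point *)

Section Levels.
Variables (K : numClosedFieldType) (N d : nat) (a : 'I_N.+1).
Local Notation Mon := (homog_monomial N.+1 d).
Implicit Types (u : Mon -> K) (x p : 'I_N.+1 -> K) (F : {mpoly K[N.+1]}).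

Definition strip (m : 'X_{1..N.+1}) : 'X_{1..N.+1} := [multinom if b == a then 0%N else m b | b < N.+1].

(* The coefficient of [X_a ^ (d - i)] in the form with coefficients [u], seen as a polynomial in
   the remaining variables. *)
Definition level u i : {mpoly K[N.+1]} :=
  \sum_(m : Mon | (mon_of m a + i == d)%N) u m *: 'X_[strip (mon_of m)].

Definition coefs F : Mon -> K := fun m => F@_(mon_of m).

Definition at_a (t : K) x : 'I_N.+1 -> K := fun b => if b == a then t else x b.

Lemma mdeg_strip (m : 'X_{1..N.+1}) : (m a + mdeg (strip m))%N = mdeg m.
Proof.
rewrite !mdegE (bigD1 a) //= [in RHS](bigD1 a) //= mnmE eqxx add0n; congr (_ + _)%N.
by apply: eq_bigr => b /negPf ne; rewrite mnmE ne.
Qed.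

Lemma level_homog u i : level u i \is i.-homog.
Proof.
apply: rpred_sum => m /eqP e; rewrite rpredZ // dhomogX /=; apply/eqP.
by apply: (@addnI (mon_of m a)); rewrite mdeg_strip mdeg_mono e.
Qed.

Lemma eval_strip (m : 'X_{1..N.+1}) x t : ('X_[strip m]).@[at_a t x] = ('X_[strip m] : {mpoly K[N.+1]}).@[x].
Proof.
rewrite !mevalX; apply: eq_bigr => b _; rewrite mnmE /at_a.
by case: eqP => // _; rewrite !expr0.
Qed.

Lemma level_at u i x t : (level u i).@[at_a t x] = (level u i).@[x].
Proof. by rewrite !meval_sum; apply: eq_bigr => m _; rewrite !mevalZ eval_strip. Qed.

Lemma eval_mon (m : 'X_{1..N.+1}) x : ('X_[m] : {mpoly K[N.+1]}).@[x] = x a ^+ m a * ('X_[strip m]).@[x].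
Proof.
rewrite !mevalX (bigD1 a) //= [in RHS](bigD1 a) //= mnmE eqxx expr0 mul1r; congr (_ * _).
by apply: eq_bigr => b /negPf ne; rewrite mnmE ne.
Qed.

Lemma level_expand F x : F \is d.-homog ->
  F.@[x] = \sum_(i < d.+1) x a ^+ (d - i) * (level (coefs F) i).@[x].
Proof.
move=> hF; rewrite {1}(homog_expand hF) meval_sum.
have ma (m : Mon) : (mon_of m a <= d)%N.
  by apply: leq_trans (eq_leq (mdeg_mono m)); rewrite mdegE (bigD1 a) //= leq_addr.
have lt (m : Mon) : (d - mon_of m a < d.+1)%N by rewrite ltnS leq_subr.
rewrite (partition_big (fun m : Mon => Ordinal (lt m)) predT) //=; apply: eq_bigr => i _.
rewrite meval_sum big_distrr /=; apply: congr_big => //= m.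
  apply/eqP/eqP => [/(congr1 val) /= <-|e]; first by rewrite subnKC.
  by apply: val_inj => /=; have := e; lia.
move=> /eqP e; rewrite !mevalZ eval_mon mulrCA; congr (_ ^+ _ * _).
by move: (congr1 val e) (ma m) => /=; lia.
Qed.

(** Two expansions with the same values for all [t] have the same coefficients. *)
Lemma level_unique F x (h : nat -> K) : F \is d.-homog ->
    (forall t, F.@[at_a t x] = \sum_(i < d.+1) t ^+ (d - i) * h i) ->
  forall i, (i <= d)%N -> (level (coefs F) i).@[x] = h i.
Proof.
move=> hF e i id.
have pe : \sum_(j < d.+1) (level (coefs F) j).@[x] *: 'X^(d - j) =
    \sum_(j < d.+1) h j *: 'X^(d - j) :> {poly K}.
  apply: poly_ext => t; rewrite !horner_sum; have := e t; rewrite (level_expand _ hF).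
  rewrite /at_a eqxx -/(at_a t x) => e'.
  transitivity (\sum_(i < d.+1) t ^+ (d - i) * (level (coefs F) i).@[at_a t x]).
    by apply: eq_bigr => j _; rewrite level_at hornerZ hornerXn mulrC.
  by rewrite e'; apply: eq_bigr => j _; rewrite hornerZ hornerXn mulrC.
have cf (g : nat -> K) : (\sum_(j < d.+1) g j *: 'X^(d - j) : {poly K})`_(d - i) = g i.
  rewrite coef_sum (bigD1 (Ordinal (id : i < d.+1)%N)) //= coefZ coefXn eqxx mulr1 big1 ?addr0 //.
  move=> j ne; rewrite coefZ coefXn; case: eqP => [ed|]; last by rewrite mulr0.
  case/eqP: ne; apply: val_inj => /=; have jd : (j <= d)%N by rewrite -ltnS.
  by rewrite -(subKn jd) -ed subKn.
have := congr1 (fun q : {poly K} => q`_(d - i)) pe.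
by rewrite (cf (fun j => (level (coefs F) j).@[x])) (cf h).
Qed.

Lemma level_lin (I : finType) (c : I -> K) (v : I -> Mon -> K) i x :
  (level (fun m => \sum_j c j * v j m) i).@[x] = \sum_j c j * (level (v j) i).@[x].
Proof.
rewrite meval_sum; under [RHS]eq_bigr do rewrite meval_sum big_distrr /=.
rewrite exchange_big; apply: eq_bigr => m _ /=; rewrite mevalZ big_distrl.
by apply: eq_bigr => j _; rewrite mevalZ mulrA.
Qed.

Lemma levelD u v i x :
  (level (fun m => u m + v m) i).@[x] = (level u i).@[x] + (level v i).@[x].
Proof.
rewrite !meval_sum -big_split; apply: eq_bigr => m _ /=; by rewrite !mevalZ mulrDl.
Qed.

Lemma eq_level u v i : u =1 v -> level u i = level v i.
Proof. by move=> /funext->. Qed.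

Lemma levelZ t u i : level (fun m => t * u m) i = t *: level u i.
Proof. by rewrite scaler_sumr; apply: eq_bigr => m _; rewrite scalerA. Qed.

(** For [p a = 1] and [e = 1] this is the linear change of coordinates that preserves [x_a] and
    sends the basis vector of index [a] to [p]; [e = -1] gives its inverse. *)
Definition shift (e : K) p : N.+1.-tuple {mpoly K[N.+1]} :=
  [tuple 'X_b + (e * (p b - (b == a)%:R)) *: 'X_a | b < N.+1].

Lemma shift_homog e p b : tnth (shift e p) b \is 1.-homog.
Proof. by rewrite tnth_mktuple rpredD ?rpredZ ?var_homog. Qed.

Lemma shift_eval e p F x :
  (F \mPo shift e p).@[x] = F.@[fun b => x b + e * (p b - (b == a)%:R) * x a].
Proof.
rewrite comp_mpoly_meval; apply: meval_eq => b.
by rewrite tnth_mktuple mevalD mevalZ !mevalXU.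
Qed.

Definition centered F p := F \mPo shift 1 p.

Lemma centered_homog F p : F \is d.-homog -> centered F p \is d.-homog.
Proof. by move=> hF; have := comp_homog hF (shift_homog 1 p); rewrite mul1n. Qed.

Lemma centeredK F p : p a = 1 -> centered F p \mPo shift (-1) p = F.
Proof.
move=> pa; apply: mpoly_ext => x; rewrite !shift_eval; apply: meval_eq => b /=.
by rewrite eqxx pa subrr mulr0 mul0r addr0; ring.
Qed.

(** The form [L_i] of the Taylor expansion of [F] at [p]. *)
Definition tlevel F p i := level (coefs (centered F p)) i.

Lemma taylor F p x : F \is d.-homog -> p a = 1 ->
  F.@[x] = \sum_(i < d.+1) x a ^+ (d - i) * (tlevel F p i).@[fun b => x b - x a * p b].
Proof.
move=> hF pa; rewrite -{1}(centeredK F pa) shift_eval.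
rewrite (level_expand _ (centered_homog p hF)) /= eqxx pa subrr mulr0 mul0r addr0.
apply: eq_bigr => i _; congr (_ * _); rewrite -(level_at _ _ _ 0) -[RHS](level_at _ _ _ 0).
by apply: meval_eq => b; rewrite /at_a; case: eqP => // _; rewrite subr0; ring.
Qed.

(** In the expansion evaluated at [p] itself, only the constant form [L_0] survives. *)
Lemma centered_at F p : p a = 1 -> F.@[p] = 0 -> F \is d.-homog ->
  (tlevel F p 0).@[fun=> 0] = 0.
Proof.
move=> pa Fp hF; rewrite -[RHS]Fp (taylor p hF pa) big_ord_recl /= pa expr1n mul1r big1 ?addr0.
  by apply: meval_eq => b; rewrite mul1r subrr.
move=> i _; rewrite expr1n mul1r.
have -> : (tlevel F p (lift ord0 i)).@[fun b => p b - 1 * p b] =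
    (tlevel F p (lift ord0 i)).@[fun b => 0 * p b].
  by apply: meval_eq => b; rewrite mul1r subrr mul0r.
by rewrite (meval_homog _ _ (level_homog _ _)) expr0n mul0r.
Qed.

End Levels.

(** * Good linear sections for general hypersurfaces *)

Section DualPoints.
Variable K : numFieldType.

Definition vec2 n (v0 v1 : K) (v : 'I_n -> K) (t : 'I_n.+2) : K :=
  if unlift ord0 t is Some t' then (if unlift ord0 t' is Some t'' then v t'' else v1) else v0.

Lemma vec2_dot n v0 v1 v w0 w1 w : \sum_(t < n.+2) vec2 v0 v1 v t * vec2 w0 w1 w t =
  v0 * w0 + (v1 * w1 + \sum_(t < n) v t * w t).
Proof.
rewrite !big_ord_recl /vec2 !unlift_none liftK unlift_none; congr (_ + (_ + _)).
by apply: eq_bigr => t _; rewrite !liftK.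
Qed.

(* The points are the last [s] basis vectors and [k + 1] points [(1, i, 0, ..., 0)] of a line; the
   dual forms of degree [k] are powers of coordinates and Lagrange polynomials. *)
Lemma dual_points s k : (0 < k)%N -> exists (y : 'I_s + 'I_k.+1 -> 'I_s.+2 -> K)
    (lam : 'I_s + 'I_k.+1 -> 'I_k -> 'I_s.+2 -> K),
  (forall j, exists t, y j t != 0) /\
  forall j j', \prod_q \sum_t lam j q t * y j' t = (j == j')%:R.
Proof.
move=> k0; pose dl (j : 'I_s) (t : 'I_s) : K := (t == j)%:R.
pose y (j : 'I_s + 'I_k.+1) := match j with
  | inl j => vec2 0 0 (dl j) | inr i => vec2 1 (i : nat)%:R (fun=> 0) end.
(* For a point of the line, these are the factors [(t_1 - i' t_0) / (i - i')] of a Lagrange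
   polynomial; [i' = lift i q] runs through the other nodes. *)
pose lam (j : 'I_s + 'I_k.+1) (q : 'I_k) := match j with
  | inl j => vec2 0 0 (dl j)
  | inr i => let w := (i : nat)%:R - (lift i q : nat)%:R in
             vec2 (- (lift i q : nat)%:R / w) (w^-1) (fun=> 0) end.
have pr0 (F : 'I_k -> K) (q : 'I_k) : F q = 0 -> \prod_q F q = 0.
  by move=> e; rewrite (bigD1 q) //= e mul0r.
have q0 : 'I_k by case: k k0 {y lam pr0} => // k _; exact: ord0.
exists y, lam; split.
  case=> [j|i]; last by exists ord0; rewrite /= /vec2 unlift_none oner_neq0.
  by exists (lift ord0 (lift ord0 j)); rewrite /= /vec2 !liftK /dl eqxx oner_neq0.
case=> [j|i] [j'|i'] /=.
- rewrite (inj_eq (@inl_inj _ _)); under eq_bigr do rewrite vec2_dot.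
  have -> : \sum_t dl j t * dl j' t = (j == j')%:R.
    rewrite (bigD1 j) //= big1 ?addr0; first by rewrite /dl eqxx mul1r.
    by move=> t /negPf ne; rewrite /dl ne mul0r.
  rewrite !mul0r !add0r big_const_ord iter_mulr_1; case: eqP => _; first by rewrite expr1n.
  by rewrite expr0n gtn_eqF.
- apply: (pr0 _ q0); rewrite vec2_dot !mul0r !add0r big1 // => t _; exact: mulr0.
- apply: (pr0 _ q0); rewrite vec2_dot !mulr0 !add0r big1 // => t _; exact: mul0r.
have nz (q : 'I_k) : (i : nat)%:R - (lift i q : nat)%:R != 0 :> K.
  by rewrite subr_eq0 eqr_nat; apply: contra (neq_lift i q) => /eqP e; apply/eqP/val_inj.
have sum0 : \sum_(t < s) (0 : K) * 0 = 0 by rewrite big1 // => t _; rewrite mul0r.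
rewrite (inj_eq (@inr_inj _ _)); have [<-|ne] := eqVneq i i'.
  rewrite big1 // => q _; rewrite vec2_dot sum0.
  by have := nz q; move: ((lift i q : nat)%:R) => x h; field.
have [q eq] := unlift_some ne; move=> _; apply: (pr0 _ q); rewrite vec2_dot sum0 eq.
by have := nz q; move: ((lift i q : nat)%:R) => x h; field.
Qed.

(** Take the two-by-two minors of [y] and [v] that contain a column where [y] is nonzero. *)
Lemma cut_point s (y : 'I_s.+1 -> K) : (exists t, y t != 0) ->
  exists C : 'I_s -> 'I_s.+1 -> K, forall v, (forall t, \sum_u C t u * v u = 0) ->
    exists tau, forall u, v u = tau * y u.
Proof.
case=> i yi; exists (fun t u => (u == lift i t)%:R * y i - (u == i)%:R * y (lift i t)) => v hv.
exists (v i / y i) => u; case: (unliftP i u) => [t|] ->; last by rewrite divfK.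
have := hv t; rewrite (bigD1 i) //= (bigD1 (lift i t)) 1?eq_sym ?neq_lift //= big1 ?addr0.
  have ne : (lift i t == i) = false by rewrite eq_sym (negPf (neq_lift i t)).
  rewrite !eqxx ne => e.
  apply: (mulIf yi); rewrite mulrAC divfK //; apply/eqP; rewrite -subr_eq0 -e; apply/eqP.
  by rewrite /=; ring.
by move=> w /andP[/negPf-> /negPf->]; rewrite !mul0r subrr mul0r.
Qed.

End DualPoints.

(** * Forms whose coefficients are algebraic over the parameters *)

Section CoefficientwiseEigen.
Variables (K : fieldType) (B : Type) (m : nat) (z : B -> 'I_m -> K) (A : set B).
Variables (I : finType) (w : B -> I -> K) (n : nat).
Implicit Types P Q : B -> {mpoly K[n]}.

Definition coef_eigen P := forall a, eigen_over z A w (fun b => (P b)@_a).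

Lemma coef_eigenM P Q : coef_eigen P -> coef_eigen Q -> coef_eigen (fun b => P b * Q b).
Proof.
move=> hP hQ a; apply: (eq_eigen _ (eigen_sum (index_enum _) (P := fun k : 'X_{1..n < (mdeg a).+1, (mdeg a).+1} => (a == (k.1 + k.2)%MM))
    (fun k _ => eigenM (hP k.1) (hQ k.2)))) => b.
by rewrite -mcoeffM.
Qed.

Lemma coef_eigen_prod (T : Type) (r : seq T) (P : T -> B -> {mpoly K[n]}) :
  (forall t, coef_eigen (P t)) -> coef_eigen (fun b => \prod_(t <- r) P t b).
Proof.
move=> hP; elim: r => [|t r IH] a.
  by apply: eq_eigen (eigen_cst z A w (1 : {mpoly K[n]})@_a) => b; rewrite big_nil.
by apply: eq_eigen (coef_eigenM (hP t) IH a) => b; rewrite big_cons.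
Qed.

Lemma coef_eigenX P k : coef_eigen P -> coef_eigen (fun b => P b ^+ k).
Proof.
move=> hP a; have := coef_eigen_prod (nseq k tt) (fun _ => hP) a; apply: eq_eigen => b.
by rewrite big_nseq iter_mulr_1.
Qed.

End CoefficientwiseEigen.

(** After the change of coordinates, the coefficients are polynomials in those of [F] and the
    coordinates of [p]. *)
Lemma coef_eigen_shift (K : numClosedFieldType) (B : Type) m (z : B -> 'I_m -> K) (A : set B)
    (I : finType) (w : B -> I -> K) N (a : 'I_N.+1) e (p : B -> 'I_N.+1 -> K) :
  (forall i, eigen_over z A w (fun b => p b i)) ->
  forall d (F : B -> {mpoly K[N.+1]}), (forall b, F b \is d.-homog) ->
  (forall al : homog_monomial N.+1 d, eigen_over z A w (fun b => coefs (F b) al)) ->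
  coef_eigen z A w (fun b => F b \mPo shift a e (p b)).
Proof.
move=> hp d F hF hc be.
pose X (al : homog_monomial N.+1 d) b := \prod_(i < N.+1) tnth (shift a e (p b)) i ^+ mon_of al i.
have hX al : coef_eigen z A w (X al).
  apply: coef_eigen_prod => i; apply: coef_eigenX => g.
  apply: eq_eigen (eigenD (eigen_cst z A w ('X_i : {mpoly K[N.+1]})@_g)
    (eigenM (eigenM (eigen_cst z A w e) (eigenD (hp i) (eigen_cst z A w (- (i == a)%:R))))
     (eigen_cst z A w ('X_a : {mpoly K[N.+1]})@_g))) => b.
  by rewrite tnth_mktuple mcoeffD mcoeffZ.
apply: eq_eigen (eigen_sum (index_enum (homog_monomial N.+1 d)) (P := xpredT)
    (fun al _ => eigenM (hc al) (hX al be))) => b.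
rewrite [in RHS](homog_expand (hF b)) (raddf_sum (comp_mpoly _)) raddf_sum /=; apply: eq_bigr => al _.
by rewrite comp_mpolyZ mcoeffZ comp_mpolyX.
Qed.

(** * Counting parameters of the configurations to be avoided *)

Section DimensionCount.
Variables (K : numClosedFieldType) (N d : nat) (a : 'I_N.+1).
Local Notation Mon := (homog_monomial N.+1 d).

(* The forms [l] cut the zero locus of the first [k] levels at [p] in the empty set of [P(x_a = 0)]. *)
Definition good s (l : 'I_s -> 'I_N.+1 -> K) k (F : {mpoly K[N.+1]}) (p : 'I_N.+1 -> K) :=
  forall x, x a = 0 -> (forall i, (0 < i <= k)%N -> (tlevel d a F p i).@[x] = 0) ->
    (forall t, \sum_b l t b * x b = 0) -> forall b, x b = 0.

Definition level_weight i (x : 'I_N.+1 -> K) (m : Mon) : K :=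
  if (mon_of m a + i == d)%N then ('X_[strip a (mon_of m)]).@[x] else 0.

Lemma level_sum (u : Mon -> K) i x : (level a u i).@[x] = \sum_m u m * level_weight i x m.
Proof.
rewrite meval_sum big_mkcond; apply: eq_bigr => m _; rewrite /level_weight.
by case: ifP => _; rewrite ?mulr0 // mevalZ.
Qed.

Variables (s k : nat) (l : 'I_s.+2 -> 'I_N.+1 -> K).
Hypotheses (kd : (k < d)%N) (sN : (k + s.+2)%N = N).
Local Notation J := ('I_s + 'I_k.+2)%type.
Variables (y : J -> 'I_s.+2 -> K) (lam : J -> 'I_k.+1 -> 'I_s.+2 -> K).
Hypothesis dual : forall j j', \prod_q \sum_t lam j q t * y j' t = (j == j')%:R.

(** The dual form of index [j], composed with [l] and restricted to [x_a = 0]; at points of this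
    hyperplane that [l] maps to the [y j'] it takes the values 0 and 1 of a dual basis. *)
Definition top_factor j : {mpoly K[N.+1]} :=
  \prod_q \sum_(b | b != a) (\sum_t lam j q t * l t b) *: 'X_b.

(** These [N + 1] forms span the directions in which the coefficients are determined by the
    equations [L_(k+1) (x_j) = 0] and [L_0 = 0]. *)
Definition pivot (v : option J) : {mpoly K[N.+1]} :=
  if v is Some j then 'X_a ^+ (d - k.+1) * top_factor j else 'X_a ^+ d.

Lemma pivot_homog v : pivot v \is d.-homog.
Proof.
have hX e : 'X_a ^+ e \is [in K[N.+1], e.-homog] by have := dhomogMn e (var_homog K a); rewrite mul1n.
case: v => [j|]; last exact: hX.
have h : top_factor j \is (\sum_(q < k.+1) 1)%N.-homog.
  by apply: prod_homog => q _; apply: rpred_sum => b _; rewrite rpredZ ?var_homog.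
by have := dhomogM (hX (d - k.+1)%N) h; rewrite sum1_card card_ord subnK.
Qed.

Lemma top_factor_eval j t x : (top_factor j).@[at_a a t x] = (top_factor j).@[x].
Proof.
rewrite !meval_prod; apply: eq_bigr => q _; rewrite !meval_sum; apply: eq_bigr => b /negPf ne.
by rewrite !mevalZ !mevalXU /at_a ne.
Qed.

Lemma top_factor_points j x : x a = 0 ->
  (top_factor j).@[x] = \prod_q \sum_t lam j q t * \sum_b l t b * x b.
Proof.
move=> xa; rewrite meval_prod; apply: eq_bigr => q _; rewrite meval_sum.
transitivity (\sum_b (\sum_t lam j q t * l t b) * x b).
  rewrite [RHS](bigD1 a) //= xa mulr0 add0r; apply: eq_bigr => b _.
  by rewrite mevalZ mevalXU.
under eq_bigr do rewrite big_distrl /=.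
rewrite exchange_big; apply: eq_bigr => t _ /=; rewrite big_distrr.
by apply: eq_bigr => b _ /=; rewrite mulrA.
Qed.

Lemma pivot_level v i x : (i <= d)%N -> (level a (coefs (d := d) (pivot v)) i).@[x] =
  if v is Some j then (if i == k.+1 then (top_factor j).@[x] else 0) else (i == 0%N)%:R.
Proof.
move=> id; case: v => [j|].
  apply: (level_unique (h := fun i => if i == k.+1 then (top_factor j).@[x] else 0)) => //.
    exact: (pivot_homog (Some j)).
  move=> t; rewrite /= mevalM mevalXn mevalXU top_factor_eval {1}/at_a eqxx.
  rewrite (bigD1 (Ordinal (kd : k.+1 < d.+1)%N)) //= eqxx big1 ?addr0 // => i' ne.
  by case: eqP => [e|]; rewrite ?mulr0 //; case/eqP: ne; apply: val_inj.
apply: (level_unique (h := fun i => (i == 0%N)%:R)) => //; first exact: (pivot_homog None).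
move=> t; rewrite /= mevalXn mevalXU {1}/at_a eqxx (bigD1 ord0) //= subn0 mulr1 big1 ?addr0 // => i' ne.
by rewrite (_ : (i' == 0 :> nat) = false) ?mulr0 //; apply: contraNF ne.
Qed.

Arguments pivot : simpl never.

Definition pivot_mx : 'M[K]_(#|{: option J}|, #|{: Mon}|) :=
  \matrix_(i, j) coefs (pivot (enum_val i)) (enum_val j : Mon).

Lemma sum_enum (T : finType) (G : T -> K) : \sum_(i < #|T|) G (enum_val i) = \sum_i G i.
Proof.
rewrite [RHS](reindex_onto enum_val enum_rank) => [|i _]; last exact: enum_rankK.
by apply: eq_bigl => i; rewrite enum_valK eqxx.
Qed.

(** The evaluations of the level [k + 1] at the points [x j], together with the level 0, form a dual
    basis to the pivots. *)
Lemma pivot_mx_free (x : J -> 'I_N.+1 -> K) : (forall j, x j a = 0) ->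
  (forall j t, \sum_b l t b * x j b = y j t) -> row_free pivot_mx.
Proof.
move=> xa hx; apply/row_freeP.
pose lv (v : option J) := if v is Some j then k.+1 else 0%N.
pose pt (v : option J) : 'I_N.+1 -> K := if v is Some j then x j else fun=> 0.
exists (\matrix_(m, v) level_weight (lv (enum_val v)) (pt (enum_val v)) (enum_val m)).
apply/matrixP => i i'; rewrite !mxE -(inj_eq enum_val_inj).
transitivity (level a (coefs (d := d) (pivot (enum_val i))) (lv (enum_val i'))).@[pt (enum_val i')].
  by rewrite level_sum -[RHS]sum_enum; apply: eq_bigr => m _; rewrite !mxE.
move: (enum_val i) (enum_val i') => v v'.
rewrite pivot_level; last by case: v'.
case: v v' => [j|] [j'|] //=; rewrite eqxx top_factor_points // (inj_eq (@Some_inj _)) -dual.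
by apply: eq_bigr => q _; apply: eq_bigr => t _; rewrite hx.
Qed.

Definition rest_mx := row_base (pivot_mx^C)%MS.

Definition rest_form (q : 'I_(\rank pivot_mx^C)) (m : Mon) : K := rest_mx q (enum_rank m).

(** The parameters will be the coefficients on a complement of the pivots and the [N] free
    coordinates of [p]: one fewer than the coefficients of a form. *)
Lemma card_forms : row_free pivot_mx -> #|{: Mon}| = (\rank pivot_mx^C + N).+1.
Proof.
move=> /eqP fr; have := mxrank_compl pivot_mx; have := rank_leq_col pivot_mx; rewrite fr.
have eJ : #|{: option J}| = N.+1 by rewrite card_option card_sum !card_ord; lia.
move: (\rank pivot_mx^C) => r; rewrite {}eJ => h ->.
by rewrite -addnS subnK.
Qed.

Lemma decompose (u : Mon -> K) : exists (c : option J -> K) (z : 'I_(\rank pivot_mx^C) -> K),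
  forall m, u m = \sum_v c v * coefs (pivot v) m + \sum_q z q * rest_form q m.
Proof.
pose U := \row_(m < #|{: Mon}|) u (enum_val m).
have : (U <= pivot_mx + rest_mx)%MS.
  rewrite (adds_eqmx (eqmx_refl _) (eq_row_base _)); apply: submx_full.
  exact: addsmx_compl_full.
case/sub_addsmxP => -[C Z] /= e.
exists (fun v => C 0 (enum_rank v)), (fun q => Z 0 q) => m.
have := congr1 (fun M : 'rV[K]__ => M 0 (enum_rank m)) e; rewrite !mxE enum_rankK => ->.
congr (_ + _); rewrite -[RHS]sum_enum; apply: eq_bigr => v _.
by rewrite mxE enum_rankK enum_valK.
Qed.

(* The configurations for which the induction step fails for all [j]. The coefficients of the
   centered form are [bc] on the pivots and [bz] on a complement of their span. *)
Record bad_point := BadPoint {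
  bF : {mpoly K[N.+1]}; bp : 'I_N.+1 -> K; bx : J -> 'I_N.+1 -> K;
  bc : option J -> K; bz : 'I_(\rank pivot_mx^C) -> K;
  bF_homog : bF \is d.-homog; bp_a : bp a = 1; bF_p : bF.@[bp] = 0;
  b_good : good l k bF bp;
  bx_a : forall j, bx j a = 0;
  bx_y : forall j t, \sum_b l t b * bx j b = y j t;
  bx_level : forall j i, (0 < i <= k.+1)%N -> (tlevel d a bF bp i).@[bx j] = 0;
  b_dec : forall m, coefs (centered a bF bp) m =
    \sum_v bc v * coefs (pivot v) m + \sum_q bz q * rest_form q m }.

Definition rest_part (b : bad_point) (m : Mon) := \sum_q bz b q * rest_form q m.

Lemma tlevel_dec b i x : (i <= d)%N -> (tlevel d a (bF b) (bp b) i).@[x] =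
  \sum_v bc b v * (level a (coefs (d := d) (pivot v)) i).@[x] + (level a (rest_part b) i).@[x].
Proof.
by move=> id; rewrite -level_lin -levelD; congr (_.@[_]); apply: eq_level => m; rewrite b_dec.
Qed.

(** The pivots live in the levels 0 and [k + 1] only, so the levels from 1 to [k] involve no unknown
    coefficient [bc]. *)
Lemma tlevel_low b i x : (0 < i <= k)%N ->
  (tlevel d a (bF b) (bp b) i).@[x] = (level a (rest_part b) i).@[x].
Proof.
move=> /andP[i0 ik]; have id : (i <= d)%N by rewrite (leq_trans ik) // ltnW.
rewrite tlevel_dec // big1 ?add0r // => v _; rewrite pivot_level //; case: v => [j|].
  by rewrite ltn_eqF ?mulr0.
by rewrite gtn_eqF ?mulr0.
Qed.

(** By duality the equation [L_(k+1) (x_j) = 0] contains a single pivot coefficient. *)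
Lemma pivot_coefficient b j :
  bc b (Some j) = - (level a (rest_part b) k.+1).@[bx b j].
Proof.
have kk : (0 < k.+1 <= k.+1)%N by rewrite leqnn.
have := @bx_level b j _ kk; rewrite tlevel_dec // => /eqP; rewrite addr_eq0 => /eqP <-.
rewrite (bigD1 (Some j)) //= pivot_level // eqxx top_factor_points; last exact: bx_a.
have e j' : \prod_q \sum_t lam j' q t * \sum_b0 l t b0 * bx b j b0 = (j' == j)%:R.
  by rewrite -dual; apply: eq_bigr => q _; apply: eq_bigr => t _; rewrite bx_y.
rewrite e eqxx mulr1 big1 ?addr0 // => -[j'|] ne; rewrite pivot_level // ?mulr0 //.
rewrite eqxx top_factor_points ?e; last exact: bx_a.
by rewrite (_ : (j' == j) = false) ?mulr0 //; apply: contraNF ne => /eqP->.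
Qed.

Lemma pivot_coefficient0 b : bc b None = - (level a (rest_part b) 0).@[fun=> 0].
Proof.
have := centered_at (bp_a b) (bF_p b) (bF_homog b).
rewrite tlevel_dec // => /eqP; rewrite addr_eq0 => /eqP <-.
rewrite (bigD1 None) //= pivot_level // mulr1 big1 ?addr0 // => -[j|] // _.
by rewrite pivot_level // mulr0.
Qed.

Lemma rest_level b i x : (level a (rest_part b) i).@[x] =
  \sum_q bz b q * (level a (rest_form q) i).@[x].
Proof. exact: level_lin. Qed.

(** The points [bx] are algebraic over the parameters [bz] and [bp], hence so are the pivot
    coefficients, the centered form, and finally [F], whose coefficients outnumber the parameters by
    one. *)
Lemma bad_dependence : row_free pivot_mx ->
  exists2 Phi : {mpoly K[#|{: Mon}|]}, Phi != 0 &
    forall b, Phi.@[fun i => coefs (bF b) (enum_val i : Mon)] = 0.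
Proof.
move=> fr; pose r := \rank pivot_mx^C.
pose z b (i : 'I_(r + N)) := match split i with inl q => bz b q | inr t => bp b (lift a t) end.
have zl b q : z b (lshift N q) = bz b q by rewrite /z (unsplitK (inl q : 'I_r + 'I_N)).
have zr b t : z b (rshift r t) = bp b (lift a t) by rewrite /z (unsplitK (inr t : 'I_r + 'I_N)).
have polyz q : polyfun z (fun b => bz b q) by exists 'X_(lshift N q) => b; rewrite mevalXU zl.
pose lf t : {mpoly K[N.+1]} := \sum_b l t b *: 'X_b.
have lfE t c : (lf t).@[c] = \sum_b l t b * c b.
  by rewrite meval_sum; apply: eq_bigr => b _; rewrite mevalZ mevalXU.
pose Ix := ('I_k + option 'I_s.+2)%type.
pose dg (i : Ix) := if i is inl i then i.+1 else 1%N.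
pose f (i : Ix) b : {mpoly K[N.+1]} := match i with
  | inl i => level a (rest_part b) i.+1 | inr None => 'X_a | inr (Some t) => lf t end.
apply: (@points_dependence K bad_point (r + N) z N.+1 Ix dg f J (fun j b => bx b j)
  #|{: Mon}| _ (card_forms fr)).
- case=> [i|[t|]] b; [exact: level_homog | | exact: var_homog].
  by apply: rpred_sum => c _; rewrite rpredZ ?var_homog.
- by case.
- case=> [i|[t|]] g; [| by exists ((lf t)@_g)%:MP => b; rewrite mevalC |
    by exists (('X_a : {mpoly K[N.+1]})@_g)%:MP => b; rewrite mevalC].
  exists (\sum_(m : Mon | (mon_of m a + i.+1 == d)%N) (\sum_q rest_form q m *: 'X_(lshift N q)) *
    (('X_[strip a (mon_of m)] : {mpoly K[N.+1]})@_g)%:MP) => b.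
  rewrite /f /level raddf_sum meval_sum; apply: eq_bigr => m _ /=.
  rewrite mcoeffZ mevalM mevalC meval_sum; congr (_ * _); apply: eq_bigr => q _.
  by rewrite mevalZ mevalXU zl mulrC.
(* That these forms have no common zero is the assumption that [l] is good for the first [k]
   levels. *)
- move=> b c hc; apply: (b_good (b := b)).
  + by have := hc (inr None); rewrite /f mevalXU.
  + case=> // i ik; rewrite tlevel_low //; exact: (hc (inl (Ordinal (ik : (i < k)%N)))).
  + by move=> t; have := hc (inr (Some t)); rewrite /f lfE.
- move=> j [i|[t|]] /=.
  + exists 0 => b; rewrite meval0 -tlevel_low ?ltn_ord // bx_level //=.
    by rewrite ltnS ltnW.
  + by exists (y j t)%:MP => b; rewrite mevalC lfE bx_y.
  + by exists 0 => b; rewrite meval0 mevalXU bx_a.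
move=> A I w hx t.
have hp i : eigen_over z A w (fun b => bp b i).
  apply: eigen_polyfun; case: (unliftP a i) => [i'|] ->.
    by exists 'X_(rshift r i') => b; rewrite mevalXU zr.
  by exists 1 => b; rewrite meval1 bp_a.
have hz q : eigen_over z A w (fun b => bz b q) by apply: eigen_polyfun.
have hc v : eigen_over z A w (fun b => bc b v).
  have hl i x : (forall c, eigen_over z A w (fun b => x b c)) ->
      eigen_over z A w (fun b => - (level a (rest_part b) i).@[x b]).
    move=> hxc; apply: (eq_eigen (g := fun b => (-1) * \sum_q bz b q * (level a (rest_form q) i).@[x b])).
      by move=> b; rewrite rest_level mulN1r.
    apply: eigenM; first exact: eigen_cst.
    by apply: eigen_sum => q _; apply: eigenM => //; apply: eigen_meval.
  case: v => [j|].
    by apply: (eq_eigen _ (hl k.+1 (fun b => bx b j) _)) => // b; rewrite pivot_coefficient.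
  apply: (eq_eigen _ (hl 0%N (fun _ _ => 0) _)) => [b|c]; first by rewrite pivot_coefficient0.
  exact: eigen_cst.
(* The form [F] is recovered from its centered form by the inverse change of coordinates. *)
have hF : coef_eigen z A w (fun b => centered a (bF b) (bp b) \mPo shift a (-1) (bp b)).
  apply: (@coef_eigen_shift _ _ _ _ _ _ _ _ _ _ _ hp d) => [b|al].
    by apply: centered_homog; apply: bF_homog.
  apply: (eq_eigen (fun b => esym (b_dec b al))); apply: eigenD.
    by apply: eigen_sum => v _; apply: eigenM => //; apply: eigen_cst.
  by apply: eigen_sum => q _; apply: eigenM => //; apply: eigen_cst.
apply: (eq_eigen _ (hF (mon_of (enum_val t)))) => b.
by rewrite centeredK ?bp_a.
Qed.

End DimensionCount.


(** * Adding one level *)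

Section InductionStep.
Variables (K : numClosedFieldType) (N d : nat) (a : 'I_N.+1).
Local Notation Mon := (homog_monomial N.+1 d).

Definition form_point (F : {mpoly K[N.+1]}) : 'I_#|{: Mon}| -> K :=
  fun i => coefs F (enum_val i : Mon).

(** The candidates [l' j] are the forms vanishing on [y j], composed with [l]; if all of them fail,
    [F] and [p] belong to a [bad_point]. *)
Lemma good_step s k (l : 'I_s.+2 -> 'I_N.+1 -> K) : (k < d)%N -> (k + s.+2)%N = N ->
  exists (T : finType) (l' : T -> 'I_s.+1 -> 'I_N.+1 -> K) (Phi : {mpoly K[#|{: Mon}|]}),
    Phi != 0 /\ forall F p, F \is d.-homog -> p a = 1 -> F.@[p] = 0 -> good d a l k F p ->
      Phi.@[form_point F] != 0 -> exists t, good d a (l' t) k.+1 F p.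
Proof.
move=> kd sN; have [y [lam [y0 dual]]] := dual_points K s (ltn0Sn k).
have [C hC] := choice (fun j => cut_point (y0 j)).
pose l' j t b := \sum_u C j t u * l u b.
have l'E j t x : \sum_b l' j t b * x b = \sum_u C j t u * \sum_b l u b * x b.
  under eq_bigr do rewrite big_distrl /=.
  rewrite exchange_big; apply: eq_bigr => u _ /=; rewrite big_distrr.
  by apply: eq_bigr => b _ /=; rewrite mulrA.
exists ('I_s + 'I_k.+2)%type, l'.
have pts F p : F \is d.-homog -> good d a l k F p -> ~ (exists j, good d a (l' j) k.+1 F p) ->
    exists x : 'I_s + 'I_k.+2 -> 'I_N.+1 -> K, forall j, [/\ x j a = 0,
      forall t, \sum_b l t b * x j b = y j t &
      forall i, (0 < i <= k.+1)%N -> (tlevel d a F p i).@[x j] = 0].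
  move=> hF hg ng.
  suff /choice[x hx] : forall j, exists x : 'I_N.+1 -> K, [/\ x a = 0,
      forall t, \sum_b l t b * x b = y j t &
      forall i, (0 < i <= k.+1)%N -> (tlevel d a F p i).@[x] = 0] by exists x.
  move=> j; apply: contrapT => nx; apply: ng; exists j => x xa xl xt b.
  apply: contrapT => xb; have [|tau htau] := hC j (fun u => \sum_b l u b * x b).
    by move=> t; rewrite -l'E.
  (* For [tau = 0], the nonzero vector [x] would be a common zero of [l] and the first [k] levels.
     So [x] can be rescaled to have image [y j]. *)
  have tau0 : tau != 0.
    apply/negP => /eqP t0; apply: xb; apply: hg => // [i /andP[i0 ik]|t].
      by apply: xl; rewrite i0 leqW.
    by rewrite htau t0 mul0r.
  apply: nx; exists (fun b => tau^-1 * x b); split=> [|t|i hi].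
  - by rewrite xa mulr0.
  - transitivity (tau^-1 * \sum_b l t b * x b); last by rewrite htau mulKf.
    by rewrite big_distrr; apply: eq_bigr => c _ /=; rewrite mulrCA.
  - by rewrite (meval_homog _ _ (level_homog _ _ _)) xl ?mulr0.
(* Points for all [j] would make the pivots independent; if they are dependent, some candidate
   always works and [Phi] is 1. *)
case: (boolP (row_free (pivot_mx d a l lam))) => fr; last first.
  exists 1; split=> [|F p hF pa Fp hg _]; first exact: oner_neq0.
  apply: contrapT => /(pts F p hF hg)[x hx]; case/negP: fr.
  by apply: (pivot_mx_free kd dual (x := x)) => j; have [] := hx j.
have [Phi P0 hP] := bad_dependence kd sN dual fr.
exists Phi; split=> // F p hF pa Fp hg PF; apply: contrapT => /(pts F p hF hg)[x hx].
have [c [z dec]] := decompose a l lam (coefs (d := d) (centered a F p)).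
case/eqP: PF; apply: (hP (@BadPoint _ _ _ _ _ _ _ _ _ F p x c z hF pa Fp hg _ _ _ dec)).
- by move=> j; have [] := hx j.
- by move=> j; have [_ h _] := hx j.
- by move=> j; have [_ _ h] := hx j.
Qed.

End InductionStep.

(** * One polynomial condition for all points *)

Section Generic.
Variables (K : numClosedFieldType).

(** The good [l] depends on [F] and [p], but [Phi] must not; so a finite family of candidates is
    fixed, and each one contributes a factor to [Phi] at the next step. For [k = 0] the coordinates
    other than [x_a] are good. *)
Lemma good_generic N d (a : 'I_N.+1) k s : (k <= d)%N -> (k + s.+1)%N = N ->
  exists (T : finType) (l : T -> 'I_s.+1 -> 'I_N.+1 -> K)
      (Phi : {mpoly K[#|{: homog_monomial N.+1 d}|]}),
    Phi != 0 /\ forall F p, F \is d.-homog -> p a = 1 -> F.@[p] = 0 ->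
      Phi.@[form_point (d := d) F] != 0 -> exists t, good d a (l t) k F p.
Proof.
elim: k s => [|k IH] s kd eN.
  rewrite add0n in eN; case: N / eN a => a.
  exists unit, (fun _ t b => (b == lift a t)%:R), 1; split=> [|F p _ _ _ _]; first exact: oner_neq0.
  exists tt => x xa _ hx b; case: (unliftP a b) => [t|] ->; last exact: xa.
  have := hx t; rewrite (bigD1 (lift a t)) //= eqxx mul1r big1 ?addr0 // => c /negPf->.
  by rewrite mul0r.
have eN' : (k + s.+2)%N = N by rewrite addnS -addSn.
have [T [l [Phi [P0 hP]]]] := IH s.+1 (ltnW kd) eN'.
pose D := {T : finType & ((T -> 'I_s.+1 -> 'I_N.+1 -> K) * {mpoly K[#|{: homog_monomial N.+1 d}|]})%type}.
have /choice[D' hD] : forall t, exists D' : D, (projT2 D').2 != 0 /\ forall F p, F \is d.-homog ->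
    p a = 1 -> F.@[p] = 0 -> good d a (l t) k F p -> (projT2 D').2.@[form_point (d := d) F] != 0 ->
    exists t', good d a ((projT2 D').1 t') k.+1 F p.
  move=> t; have [T' [l' [Phi' h]]] := good_step a (l t) kd eN'.
  by exists (existT _ T' (l', Phi')).
exists {t : T & projT1 (D' t)}, (fun t => (projT2 (D' (tag t))).1 (tagged t)).
exists (Phi * \prod_t (projT2 (D' t)).2); split.
  by rewrite mulf_neq0 //; apply/prodf_neq0 => t _; have [] := hD t.
move=> F p hF pa Fp; rewrite mevalM mulf_eq0 negb_or => /andP[h1 h2].
have [t ht] := hP F p hF pa Fp h1; have [_ hDt] := hD t.
have [|t' ht'] := hDt F p hF pa Fp ht; last by exists (Tagged (fun t => projT1 (D' t)) t').
by move: h2; rewrite meval_prod => /prodf_neq0/(_ t isT).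
Qed.

Lemma good_scale N d (a : 'I_N.+1) k s (l : 'I_s -> 'I_N.+1 -> K) t F p : t != 0 ->
  good d a l k (t *: F) p -> good d a l k F p.
Proof.
move=> t0 hg x xa xl; apply: hg => // i hi.
rewrite /tlevel (@eq_level _ _ _ _ _ (fun m => t * coefs (centered a F p) m)).
  by rewrite levelZ mevalZ xl ?mulr0.
by move=> m; rewrite /coefs /centered comp_mpolyZ mcoeffZ.
Qed.

(** Multiply the conditions for all [a] and [k] and take a nonzero homogeneous part. *)
Lemma good_generic_homog N d : exists (Phi : {mpoly K[#|{: homog_monomial N.+1 d}|]}) e,
  [/\ Phi != 0, Phi \is e.-homog & forall F, F \is d.-homog ->
    Phi.@[form_point (d := d) F] != 0 -> forall a p k s, (k <= d)%N -> (k + s.+1)%N = N ->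
    p a = 1 -> F.@[p] = 0 -> exists l : 'I_s.+1 -> 'I_N.+1 -> K, good d a l k F p].
Proof.
have /choice[Q hQ] : forall ak : 'I_N.+1 * 'I_N.+1,
    exists Phi : {mpoly K[#|{: homog_monomial N.+1 d}|]}, Phi != 0 /\
    forall s, (ak.2 <= d)%N -> (ak.2 + s.+1)%N = N -> forall F p, F \is d.-homog -> p ak.1 = 1 ->
    F.@[p] = 0 -> Phi.@[form_point (d := d) F] != 0 ->
    exists l : 'I_s.+1 -> 'I_N.+1 -> K, good d ak.1 l ak.2 F p.
  move=> [a k] /=; have [[kd kN]|h] := pselect ((k <= d)%N /\ (k < N)%N); last first.
    exists 1; split=> [|s kd eN]; first exact: oner_neq0.
    by case: h; split=> //; rewrite -[X in (_ < X)%N]eN addnS ltnS leq_addr.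
  have eN : (k + (N - k.+1).+1)%N = N by rewrite -subSn // subSS subnKC // ltnW.
  have [T [l [Phi [P0 hP]]]] := good_generic a kd eN.
  exists Phi; split=> // s _ es F p hF pa Fp PF; have [t ht] := hP F p hF pa Fp PF.
  have -> : s = (N - k.+1)%N by move: es kN; lia.
  by exists (l t).
pose Phi := \prod_ak Q ak.
have P0 : Phi != 0 by apply/prodf_neq0 => ak _; have [] := hQ ak.
have [e pe] : exists e, pihomog mdeg e Phi != 0.
  apply: contrapT => h; move/eqP: P0; apply.
  rewrite (pihomog_partitionE (leqnn (msize Phi))) big1 // => i _.
  by apply/eqP; apply: contrapT => /negP hi; apply: h; exists i.
exists (pihomog mdeg e Phi), e; split=> //; first exact: pihomogP.
move=> F hF PF a p k s kd eN pa Fp.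
(* If the homogeneous part is nonzero at [F], then the whole product is nonzero at some multiple of
   [F], which has the same good forms. *)
have [t t0 Pt] : exists2 t, t != 0 & Phi.@[fun i => t * form_point (d := d) F i] != 0.
  apply: contrapT => h; move/eqP: PF; apply; apply: pihomog_eval0 => t t0.
  by apply: contrapT => /eqP hP; apply: h; exists t.
have kN : (k < N.+1)%N by move: eN; lia.
have [_ hq] := hQ (a, Ordinal kN).
have [|||l hl] := hq s kd eN (t *: F) p _ pa.
- by rewrite rpredZ.
- by rewrite mevalZ Fp mulr0.
- move: Pt; rewrite meval_prod => /prodf_neq0/(_ (a, Ordinal kN) isT).
  by congr (_ != 0); apply: meval_eq => i; rewrite /form_point /coefs mcoeffZ.
by exists l; apply: good_scale t0 hl.
Qed.

End Generic.

(** * Tangent cones *)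

Section TangentCones.
Local Open Scope classical_set_scope.
Variables (K : numClosedFieldType) (n d : nat) (F : {mpoly K[n.+2]}) (p : 'rV[K]_n.+2).
Variables (a : 'I_n.+2).
Hypotheses (hF : F \is d.-homog) (pa : p 0 a != 0) (Fp : F.@[p 0] = 0).
Implicit Types (q x : 'rV[K]_n.+2).

Definition unit_point (b : 'I_n.+2) : K := p 0 b / p 0 a.
Local Notation L := (tlevel d a F unit_point).

(* The projection from [p] to the hyperplane [x_a = 0]. *)
Definition from_p x (b : 'I_n.+2) : K := x 0 b - x 0 a * unit_point b.

Lemma unit_point_a : unit_point a = 1.
Proof. by rewrite /unit_point divff. Qed.

Lemma unit_point_zero : F.@[unit_point] = 0.
Proof.
rewrite (_ : _.@[_] = F.@[fun b => (p 0 a)^-1 * p 0 b]); first by rewrite (meval_homog _ _ hF) Fp mulr0.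
by apply: meval_eq => b; rewrite mulrC.
Qed.

Lemma L_homog i : L i \is i.-homog.
Proof. exact: level_homog. Qed.

Lemma L0 (x : 'I_n.+2 -> K) : (L 0).@[x] = 0.
Proof.
have := centered_at unit_point_a unit_point_zero hF.
by rewrite (homog0_const (L_homog 0)) !mevalC.
Qed.

Lemma from_p_line q (s t : K) b : from_p (s *: p + t *: q) b = t * from_p q b.
Proof. by rewrite /from_p /unit_point !mxE; field. Qed.

Lemma eval_line q (s t : K) : F.@[(s *: p + t *: q) 0] =
  \sum_(i < d.+1) (s * p 0 a + t * q 0 a) ^+ (d - i) * (t ^+ i * (L i).@[from_p q]).
Proof.
rewrite (taylor _ hF unit_point_a); apply: eq_bigr => i _; rewrite -(meval_homog _ _ (L_homog i)).
by congr (_ ^+ _ * _); [rewrite !mxE | apply: meval_eq => b; exact: from_p_line].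
Qed.

Lemma restrict_eval q t : (restrict_to_line F p q).[t] = F.@[(p + t *: q) 0].
Proof.
rewrite /restrict_to_line /mmap horner_sum mevalE; apply: eq_bigr => m _.
rewrite hornerM hornerC; congr (_ * _); rewrite /mmap1 horner_prod; apply: eq_bigr => i _.
by rewrite horner_exp !hornerE !mxE mulrC.
Qed.

Lemma restrict_expand q : restrict_to_line F p q =
  \sum_(i < d.+1) ((p 0 a)%:P + q 0 a *: 'X) ^+ (d - i) * ('X^i * ((L i).@[from_p q])%:P).
Proof.
apply: poly_ext => t; rewrite restrict_eval -[p in LHS]scale1r eval_line horner_sum.
by apply: eq_bigr => i _; rewrite !hornerE [t * _]mulrC.
Qed.

(** The coefficient of [T ^ j] is a nonzero multiple of the value of [L_j] plus multiples of earlier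
    values, because [p 0 a] is nonzero. *)
Lemma restrict_coef0 q h : (h <= d.+1)%N ->
    (forall j, (j < h)%N -> (restrict_to_line F p q)`_j = 0) ->
  forall j, (j < h)%N -> (L j).@[from_p q] = 0.
Proof.
move=> hd h0; elim/ltn_ind => j IH jh; have := h0 j jh.
have jd : (j < d.+1)%N := leq_trans jh hd.
rewrite restrict_expand coef_sum (bigD1 (Ordinal jd)) //= big1 ?addr0.
  rewrite mulrA coefMC coefMXn ltnn subnn => /eqP; rewrite mulf_eq0 => /orP[|/eqP//].
  rewrite -horner_coef0 horner_exp !hornerE expf_eq0 => /andP[_].
  by rewrite (negPf pa).
move=> i ne; rewrite mulrA coefMC coefMXn; case: ltnP => [_|ij]; first by rewrite mul0r.
rewrite IH ?mulr0 //; last by apply: leq_ltn_trans ij jh.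
by rewrite ltn_neqAle ij andbT; apply: contra ne => /eqP e; apply/eqP/val_inj.
Qed.

Lemma free_pair q s t : free [:: p; q] -> (s != 0) || (t != 0) -> s *: p + t *: q != 0.
Proof.
rewrite free_cons span_seq1 seq1_free => /andP[pq q0] st; apply/negP => /eqP e.
have [s0|s0] := eqVneq s 0.
  move: st e; rewrite s0 eqxx scale0r add0r => /= t0 /eqP.
  by rewrite scaler_eq0 (negPf t0) (negPf q0).
case/negP: pq; apply/vlineP; exists (- (t / s)); apply: (scalerI s0).
by rewrite scalerA mulrN mulrCA divff // mulr1 scaleNr; apply/eqP; rewrite -addr_eq0 e.
Qed.

Lemma line_in_hypersurface q : free [:: p; q] ->
  proj_line p q `<=` hypersurface F -> restrict_to_line F p q = 0.
Proof.
move=> fr h; apply: poly_ext => t; rewrite horner0 restrict_eval.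
have x0 : p + t *: q != 0 by rewrite -[p]scale1r free_pair ?oner_eq0.
have [|_] := h (p + t *: q); last exact.
by split=> //; exists 1, t; rewrite scale1r.
Qed.

Lemma mult_ge q h : (0 < h)%N -> (h <= intersection_mult F p q)%N ->
  forall j, (j < h)%N -> (restrict_to_line F p q)`_j = 0.
Proof.
rewrite /intersection_mult => h0; have [->|nz] := eqVneq (restrict_to_line F p q) 0.
  by move=> _ j _; rewrite coef0.
rewrite mup_geq // subr0 => /dvdpP[r ->] j jh; by rewrite coefMXn jh.
Qed.

Lemma contact_line q h : (h <= d.+1)%N -> (forall i, (0 < i < h)%N -> (L i).@[from_p q] = 0) ->
  proj_line p q `<=` hypersurface F \/ (h <= intersection_mult F p q)%N.
Proof.
move=> hd hL; have [e|nz] := eqVneq (restrict_to_line F p q) 0; [left | right].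
  have L0' : forall j, (j < d.+1)%N -> (L j).@[from_p q] = 0.
    by apply: restrict_coef0 => // j _; rewrite e coef0.
  move=> x [x0 [s [t ex]]]; split=> // _ ->; rewrite ex eval_line big1 // => i _.
  by rewrite L0' // !mulr0.
rewrite /intersection_mult mup_geq // subr0 restrict_expand; elim/big_ind: _ => [|u v|i _]; [exact: dvdp0 | exact: dvdp_add |].
have [ih|ih] := ltnP i h.
  have -> : (L i).@[from_p q] = 0; last by rewrite !mulr0 dvdp0.
  by case: (posnP i) => [->|i0]; [exact: L0 | apply: hL; rewrite i0].
by rewrite dvdp_mull // dvdp_mulr // -(subnK ih) exprD dvdp_mull.
Qed.

Definition cone_form i : {mpoly K[n.+2]} :=
  L i \mPo [tuple 'X_b - unit_point b *: 'X_a | b < n.+2].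

Lemma cone_form_homog i : cone_form i \is i.-homog.
Proof.
have := @comp_homog K _ n.+2 i 1 (L i) [tuple 'X_b - unit_point b *: 'X_a | b < n.+2] (L_homog i).
rewrite mul1n; apply => b; by rewrite tnth_mktuple rpredB ?rpredZ ?var_homog.
Qed.

Lemma cone_formE i (x : 'I_n.+2 -> K) : (cone_form i).@[x] = (L i).@[fun b => x b - x a * unit_point b].
Proof.
rewrite comp_mpoly_meval; apply: meval_eq => b.
by rewrite tnth_mktuple mevalB mevalZ !mevalXU mulrC.
Qed.

Definition contact_cone h : set 'rV[K]_n.+2 :=
  zero_locus [set f | exists2 i, (0 < i < h)%N & f = cone_form i].

Lemma contact_cone_closed h : zariski_closed (contact_cone h).
Proof. by apply: zero_locus_closed => _ [i _ ->]; exists i; apply: cone_form_homog. Qed.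

(** The contact of a line with the hypersurface is read off from the values of the [L_i] at its
    projection from [p]. In particular the locus swept out by the lines is already closed. *)
Lemma tangent_locusE h : (2 <= h <= n.+1)%N -> (h <= d)%N -> tangent_locus F h p = contact_cone h.
Proof.
move=> /andP[h2 hn] hd; have h0 : (0 < h)%N by apply: ltnW.
have hd' : (h <= d.+1)%N by apply: leqW.
have p0 : p != 0 by apply: contraNneq pa => ->; rewrite mxE.
apply/seteqP; split=> x.
  case=> q [fr contact [x0 [s [t ex]]]]; split=> // _ [i /andP[i0 ih] ->].
  have Lq : (L i).@[from_p q] = 0.
    apply: (restrict_coef0 hd' _ ih); case: contact => [/(line_in_hypersurface fr)->|hm] j jh.
      by rewrite coef0.
    exact: mult_ge hm j jh.
  rewrite cone_formE (_ : _.@[_] = (L i).@[fun b => t * from_p q b]).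
    by rewrite (meval_homog _ _ (L_homog i)) Lq mulr0.
  by apply: meval_eq => b; rewrite -(from_p_line _ s) -ex.
case=> x0 hx.
have [ex|/existsNP[b xb]] := pselect (forall b, from_p x b = 0); last first.
  exists x; split.
  - rewrite free_cons span_seq1 seq1_free x0 andbT; apply/negP => /vlineP[c e].
    apply: xb; rewrite /from_p /unit_point e !mxE.
    have c0 : c != 0 by apply: contraNneq p0 => c0; rewrite e c0 scale0r.
    have xa : x 0 a != 0 by apply: contraNneq pa => xa; rewrite e mxE xa mulr0.
    by field; rewrite xa.
  - by apply: contact_line => // i hi; rewrite -cone_formE hx //; exists i.
  - by split=> //; exists 0, 1; rewrite scale0r scale1r add0r.
(* For [x] proportional to [p] some tangent line must be found: its direction is a common zero of
   [x_a] and the [h - 1] levels, which exists because [h <= n + 1]. *)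
pose f (o : option 'I_h.-1) : {mpoly K[n.+2]} := if o is Some i then L i.+1 else 'X_a.
have [|||c [[j cj] hc]] := @forms_common_zero K n.+2 (option 'I_h.-1)
    (fun o => if o is Some i then i.+1 else 1%N) f.
- by case=> [i|]; [apply: L_homog | apply: var_homog].
- by case.
- by rewrite card_option card_ord prednK.
have ca : c a = 0 by have := hc None; rewrite /f mevalXU.
pose q : 'rV[K]_n.+2 := \row_b c b.
have q0 : q != 0 by apply/negP => /eqP/rowP/(_ j)/eqP; rewrite !mxE (negPf cj).
exists q; split.
- rewrite free_cons span_seq1 seq1_free q0 andbT; apply/negP => /vlineP[t e].
  by move: pa; rewrite e !mxE ca mulr0 eqxx.
- apply: contact_line => // i /andP[i0 ih].
  have ih' : (i.-1 < h.-1)%N by move: i0 ih; lia.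
  have := hc (Some (Ordinal ih')); rewrite /f /= prednK // => e; rewrite -[RHS]e.
  by apply: meval_eq => b; rewrite /from_p !mxE ca mul0r subr0.
split=> //; exists (x 0 a / p 0 a), 0; apply/rowP => b; rewrite scale0r addr0 mxE.
have /eqP := ex b; rewrite subr_eq0 => /eqP ->; rewrite /unit_point; by field.
Qed.

Lemma tangent_coneE h : (2 <= h <= n.+1)%N -> (h <= d)%N -> tangent_cone F h p = contact_cone h.
Proof.
move=> h2 hd; rewrite /tangent_cone tangent_locusE //; apply/seteqP; split=> x.
  by apply=> //; apply: contact_cone_closed.
by move=> hx Z _; apply.
Qed.

(** The [h - 1] equations and [s + 1] linear forms number [n + 1], so they have a common zero in
    [n + 2] variables; this gives the lower bound. For the upper bound, the good forms together with
    [x_a] cut the cone in the empty set. *)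
Lemma contact_cone_dimension h s (l : 'I_s.+1 -> 'I_n.+2 -> K) : (2 <= h <= n.+1)%N ->
    (h.-1 + s.+1)%N = n.+1 -> good d a l h.-1 F unit_point ->
  has_dimension (contact_cone h) s.+1.
Proof.
move=> /andP[h2 hn] sh hg; split.
  apply: irreducible_chain_exists; first exact: contact_cone_closed.
  move=> g hgl.
  have [|||c [[j cj] hc]] := @forms_common_zero K n.+2 ('I_h.-1 + 'I_s.+1)%type
    (fun o => match o with inl i => i.+1 | inr _ => 1%N end)
    (fun o => match o with inl i => cone_form i.+1 | inr i => g i end).
  - by case=> i; [apply: cone_form_homog | apply: hgl].
  - by case.
  - by rewrite card_sum !card_ord sh.
  exists (\row_b c b).
    split; first by apply/negP => /eqP/rowP/(_ j)/eqP; rewrite !mxE (negPf cj).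
    move=> _ [i /andP[i0 ih] ->]; have ih' : (i.-1 < h.-1)%N by move: i0 ih; lia.
    have := hc (inl (Ordinal ih')); rewrite /= prednK // => e; rewrite -[RHS]e.
    by apply: meval_eq => b; rewrite mxE.
  by move=> i; have e := hc (inr i); rewrite -[RHS]e; apply: meval_eq => b; rewrite mxE.
move=> r hr; rewrite -ltnS.
pose g (i : 'I_s.+2) : {mpoly K[n.+2]} :=
  if unlift ord0 i is Some t then \sum_b l t b *: 'X_b else 'X_a.
apply: (@irreducible_chain_bound K n.+2 'I_h.-1 (fun i => i.+1) (fun i => cone_form i.+1) s.+2 g
  (contact_cone h) r) => //.
- by move=> i; apply: cone_form_homog.
- move=> i; rewrite /g; case: unlift => [t|]; last exact: var_homog.
  by apply: rpred_sum => b _; rewrite rpredZ ?var_homog.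
- move=> c hc gc.
  have ca : c a = 0 by have := gc ord0; rewrite /g unlift_none mevalXU.
  apply: hg => // [i /andP[i0 ih]|t].
    have ih' : (i.-1 < h.-1)%N by move: i0 ih; lia.
    have := hc (Ordinal ih'); rewrite /= prednK // cone_formE => e; rewrite -[RHS]e.
    by apply: meval_eq => b; rewrite ca mul0r subr0.
  have := gc (lift ord0 t); rewrite /g liftK meval_sum => e; rewrite -[RHS]e.
  by apply: eq_bigr => b _; rewrite mevalZ mevalXU.
move=> x [x0 hx] i; apply: hx; exists i.+1 => //.
by have := ltn_ord i; lia.
Qed.

End TangentCones.

(** * Tangent cones of a general complex hypersurface *)

Local Open Scope complex_scope.

Theorem theorem1p1 (R : realType) (n d : nat) (hn : (2 <= n)%N)
    (hd : (2 <= d)%N) :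
  for_general_hypersurface d (fun F : {mpoly R[i][n.+2]} =>
    forall p : 'rV[R[i]]_n.+2, hypersurface F p ->
    forall h : nat, (2 <= h <= minn n.+1 d)%N ->
      has_dimension (tangent_cone F h p) (n + 2 - h)%N).
Proof.
have [Phi [e [P0 hPhi gen]]] := good_generic_homog R[i] n.+1 d.
have [al _] : exists al : homog_monomial n.+2 d, mon_of al = (U_(ord0) *+ d)%MM.
  by apply: monoP; rewrite mdegMn mdeg1 mul1n.
exists (proj_space (K := R[i]) (N := _) `\` zero_locus [set Phi])%classic; split.
- exists (zero_locus [set Phi]); split=> //; exact: form_locus_closed hPhi.
(* The extra factor, a coordinate of the parameter space, ensures that the point found is
   nonzero. *)
- have [v hv] : exists v, (Phi * 'X_(enum_rank al)).@[v] != 0.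
    apply: contrapT => h; have : Phi * 'X_(enum_rank al) = 0.
      by apply: meval_eq0 => v; apply: contrapT => /eqP hv; apply: h; exists v.
    move/eqP; rewrite mulf_eq0 (negPf P0) /= => /eqP/(congr1 (mcoeff U_(enum_rank al))).
    by rewrite mcoeffX eqxx mcoeff0 => /eqP; rewrite oner_eq0.
  move: hv; rewrite mevalM mevalXU mulf_eq0 negb_or => /andP[Pv v0].
  exists (\row_i v i); split.
    by apply/negP => /eqP/rowP/(_ (enum_rank al))/eqP; rewrite !mxE (negPf v0).
  case=> _ /(_ Phi erefl)/eqP; apply/negP; apply: contra Pv => /eqP <-; apply/eqP.
  by apply: meval_eq => i; rewrite mxE.
move=> F hF [cF0 nPhi] p [p0 hp] h /andP[h2]; rewrite leq_min => /andP[hn1 hd1].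
have Fp : F.@[p 0] = 0 by apply: hp.
have PF : Phi.@[form_point (d := d) F] != 0.
  apply/negP => /eqP PF; apply: nPhi; split=> // _ ->; rewrite -[RHS]PF.
  by apply: meval_eq => i; rewrite mxE.
have /rV0Pn[a pa] := p0.
(* The number of good forms is [n + 2 - h], the expected dimension of the cone. *)
have sh : (h.-1 + (n.+1 - h).+1)%N = n.+1 by lia.
have kd : (h.-1 <= d)%N by lia.
have [l hl] := gen F hF PF a (unit_point p a) h.-1 (n.+1 - h)%N kd sh (unit_point_a pa)
  (unit_point_zero a hF Fp).
rewrite (tangent_coneE hF pa Fp) ?h2 //.
have -> : (n + 2 - h)%N = (n.+1 - h).+1 by lia.
by apply: contact_cone_dimension hl; rewrite ?h2.
Qed.
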